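(* Let $G$ be a connected non-compact semi-simple Lie group with finite center and no compact factors. Let $(\pi,\mathcal{H}_\pi)$ be a discrete series $\sigma$-representation of $G$ with formal dimension $d_\pi$ and let $\eta\in\mathcal{H}_\pi\setminus\{0\}$. Let $\Gamma\le G$ be a lattice. Suppose that $\Lambda\subset\Gamma$ is a finite subgroup containing the center $Z(\Gamma)$ and such that there exists $u:\Lambda\to\mathbb{T}$ satisfying $\pi(\gamma)\eta=u(\gamma)\eta$ for all $\gamma\in\Lambda$. Let $X$ be a set of representatives of $\Gamma/\Lambda$. Then: (i) If $(\pi(\gamma)\eta)_{\gamma\in\Gamma}$ is a frame for $\mathcal{H}_\pi$, then $\mathrm{vol}(G/\Gamma)\,d_\pi\le|\Lambda|^{-1}$. (ii) If $(\pi(\gamma)\eta)_{\gamma\in X}$ is a Riesz sequence in $\mathcal{H}_\pi$, then $\mathrm{vol}(G/\Gamma)\,d_\pi\ge|\Lambda|^{-1}$.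
   Context: ''No compact factors'' means no non-trivial connected normal compact subgroups. Fix a Haar measure $\mu_G$ on $G$. A $\sigma$-representation $(\pi,\mathcal{H}_\pi)$ of $G$ is a map $\pi:G\to\mathcal{U}(\mathcal{H}_\pi)$ into the unitary operators of a complex Hilbert space with $\pi(e_G)=\mathrm{id}$ and $\pi(x)\pi(y)=\sigma(x,y)\pi(xy)$ for all $x,y\in G$, for some $\sigma:G\times G\to\mathbb{T}$ (the cocycle), such that $x\mapsto\langle f,\pi(x)g\rangle$ is Borel measurable for all $f,g\in\mathcal{H}_\pi$. It is a discrete series $\sigma$-representation if it is irreducible and square-integrable, i.e. $\int_G|\langle\eta,\pi(x)\eta\rangle|^2\,d\mu_G(x)<\infty$ for some $\eta\ne0$. Then its formal dimension $d_\pi>0$ is the unique number with $\int_G|\langle f,\pi(x)\eta\rangle|^2\,d\mu_G(x)=d_\pi^{-1}\|f\|^2\|\eta\|^2$ for all $f,\eta\in\mathcal{H}_\pi$. A lattice is a discrete subgroup $\Gamma\le G$ such that $G/\Gamma$ has a finite $G$-invariant Radon measure; $\mathrm{vol}(G/\Gamma)$ is the covolume with respect to $\mu_G$ (the $\mu_G$-measure of a fundamental domain). A countable family $(g_i)_{i\in I}$ in a Hilbert space $\mathcal{H}$ is a frame for $\mathcal{H}$ if there are constants $0<A\le B<\infty$ with $A\|f\|^2\le\sum_{i\in I}|\langle f,g_i\rangle|^2\le B\|f\|^2$ for all $f\in\mathcal{H}$; it is a Riesz sequence in $\mathcal{H}$ if there are constants $0<A\le B<\infty$ with $A\|c\|_{\ell^2}^2\le\|\sum_{i\in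 I}c_ig_i\|^2\le B\|c\|_{\ell^2}^2$ for all $c\in\ell^2(I)$. *)

(* Defs.v *)
From HB Require Import structures.
From mathcomp Require Import all_boot all_order all_algebra.
From mathcomp Require Import finmap complex.
From mathcomp Require Import all_classical all_reals all_analysis.

Set Implicit Arguments.
Unset Strict Implicit.
Unset Printing Implicit Defensive.

Import Order.TTheory GRing.Theory Num.Theory.
Import numFieldNormedType.Exports.

Local Open Scope classical_set_scope.
Local Open Scope ring_scope.
Local Open Scope complex_scope.

Section Ck.
Context {R : realType} {V W : normedModType R}.

(* On finite-dimensional spaces and for U open, this is the usual notion of a
   C^k map: all iterated directional derivatives up to order k exist and are
   continuous on U. *)
Fixpoint Ck (k : nat) (U : set V) (f : V -> W) : Prop :=
  (forall x, U x -> {for x, continuous f}) /\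
  if k is k'.+1 then
    forall v, (forall x, U x -> derivable f x v) /\ Ck k' U (fun x => 'D_v f x)
  else True.

Definition smooth_on (U : set V) (f : V -> W) : Prop := forall k, Ck k U f.

End Ck.

(* The map chart_inv is only meaningful on the image of chart_dom. *)
Record chart (R : realType) (n : nat) (G : Type) := Chart {
  chart_dom : set G;
  chart_map :> G -> 'rV[R]_n;
  chart_inv : 'rV[R]_n -> G }.

Section Charts.
Context {R : realType} {n : nat} {G : topologicalType}.
Implicit Types c : chart R n G.

Definition chart_img c : set 'rV[R]_n := c @` chart_dom c.

Definition is_chart c : Prop :=
  [/\ open (chart_dom c), open (chart_img c),
      forall x, chart_dom c x -> chart_inv c (c x) = x,
      forall x, chart_dom c x -> {for x, continuous c} &
      forall y, chart_img c y -> {for y, continuous (chart_inv c)}].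

Definition smooth_compatible c c' : Prop :=
  smooth_on (chart_img c `&` chart_inv c @^-1` chart_dom c')
            (fun y => c' (chart_inv c y)).

Definition smooth_atlas (A : set (chart R n G)) : Prop :=
  [/\ forall c, A c -> is_chart c,
      forall x, exists2 c, A c & chart_dom c x &
      forall c c', A c -> A c' -> smooth_compatible c c'].

End Charts.

HB.mixin Record PointedTopologicalGroup_isTopologicalGroup G
    of PointedTopological G & Group G := {
  mulg_continuous : continuous (fun p : G * G => p.1 * p.2)%g;
  invg_continuous : continuous (fun x : G => x^-1)%g }.

#[short(type="topologicalGroupType")]
HB.structure Definition TopologicalGroup :=
  {G of PointedTopological G & Group G
      & PointedTopologicalGroup_isTopologicalGroup G}.

Section LocalGroup.
Context {R : realType} {n : nat} {G : topologicalGroupType}.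
Implicit Types c : chart R n G.

Definition smooth_mul (A : set (chart R n G)) : Prop :=
  forall c1 c2 c3, A c1 -> A c2 -> A c3 ->
    smooth_on
      [set p : 'rV[R]_n * 'rV[R]_n |
        [/\ chart_img c1 p.1, chart_img c2 p.2 &
            chart_dom c3 (chart_inv c1 p.1 * chart_inv c2 p.2)%g]]
      (fun p => c3 (chart_inv c1 p.1 * chart_inv c2 p.2)%g).

Definition smooth_inv (A : set (chart R n G)) : Prop :=
  forall c1 c2, A c1 -> A c2 ->
    smooth_on
      [set y : 'rV[R]_n | chart_img c1 y /\ chart_dom c2 (chart_inv c1 y)^-1%g]
      (fun y => c2 (chart_inv c1 y)^-1%g).

End LocalGroup.

HB.mixin Record isLieGroup (R : realType) (n : nat) G of TopologicalGroup G := {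
  lie_atlas : set (chart R n G);
  lie_hausdorff : hausdorff_space G;
  lie_second_countable : @second_countable G;
  lie_atlasP : smooth_atlas lie_atlas;
  lie_mulP : smooth_mul lie_atlas;
  lie_invP : smooth_inv lie_atlas }.

#[short(type="lieGroupType")]
HB.structure Definition LieGroup (R : realType) (n : nat) :=
  {G of TopologicalGroup G & isLieGroup R n G}.

Section LieAlgebra.
Context {R : realType} {n : nat}.

(* Bracket of the Lie algebra read in a chart c at the identity, T_1 G
   being identified with R^n through c: if m is the multiplication read in c and
   X_v is the left-invariant vector field with value v at 1, then X_v(x) is the
   derivative of m(x, .) at c 1 along v, hence
   [X_u, X_v](1) = D_u X_v - D_v X_u. *)
Definition lie_bracket (G : lieGroupType R n) (c : chart R n G)
    (u v : 'rV[R]_n) : 'rV[R]_n :=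
  let m x y := c (chart_inv c x * chart_inv c y)%g in
  let X w x := 'D_w (m x) (c 1%g) in
  'D_u (X v) (c 1%g) - 'D_v (X u) (c 1%g).

Variable br : 'rV[R]_n -> 'rV[R]_n -> 'rV[R]_n.

Definition lie_ideal (I : {vspace 'rV[R]_n}) : Prop :=
  forall u v, v \in I -> br u v \in I.

(* For a bilinear bracket, the span of all [u, v] with u, v in V. *)
Definition lie_derived (V : {vspace 'rV[R]_n}) : {vspace 'rV[R]_n} :=
  <<[seq br u v | u <- vbasis V, v <- vbasis V]>>%VS.

Definition lie_solvable (V : {vspace 'rV[R]_n}) : Prop :=
  exists k, iter k lie_derived V = 0%VS.

Definition lie_semisimple : Prop :=
  forall I, lie_ideal I -> lie_solvable I -> I = 0%VS.

End LieAlgebra.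

Definition semisimple_group (R : realType) (n : nat) (G : lieGroupType R n) :=
  forall c : chart R n G, lie_atlas c -> chart_dom c 1%g ->
    lie_semisimple (lie_bracket c).

Definition group_center (G : groupType) : set G :=
  [set z | forall g, z * g = g * z]%g.
Arguments group_center G : clear implicits.

Definition subgroup_center (G : groupType) (Gamma : groupClosed G) : set G :=
  [set z | z \in Gamma /\ forall g, g \in Gamma -> z * g = g * z]%g.

Definition normal_subgroup (G : groupType) (N : groupClosed G) : Prop :=
  forall g x, x \in N -> (g * x * g^-1)%g \in N.

Definition no_compact_factors (G : topologicalGroupType) : Prop :=
  forall K : groupClosed G, normal_subgroup K ->
    connected [set` K] -> compact [set` K] -> [set` K] = [set 1%g].

Notation borel T := (g_sigma_algebraType (@open T)).

Section Radon.
Context {R : realType} {T : ptopologicalType}.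
Local Open Scope ereal_scope.

Definition radon (mu : {measure set (borel T) -> \bar R}) : Prop :=
  [/\ forall K : set T, compact K -> mu K < +oo,
      forall A : set (borel T), measurable A ->
        mu A = ereal_inf [set mu U | U in [set U : set T | open U /\ A `<=` U]] &
      forall U : set T, open U ->
        mu U = ereal_sup [set mu K | K in [set K : set T | compact K /\ K `<=` U]]].

End Radon.

Definition haar_measure (R : realType) (G : topologicalGroupType)
    (mu : {measure set (borel G) -> \bar R}) : Prop :=
  [/\ radon mu, mu setT <> 0%E &
      forall (g : G) (A : set (borel G)), measurable A ->
        mu [set x : G | A (g * x)%g] = mu A].

Section Quotient.
Context {G : topologicalGroupType} (Gamma : groupClosed G).
Local Open Scope quotient_scope.

Definition coset_rel : rel G := fun x y => (x^-1 * y)%g \in Gamma.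

Lemma coset_rel_equiv : equiv_class_of coset_rel.
Proof.
split=> [x|x y|y x z]; rewrite /coset_rel.
- by rewrite mulVg gpred1.
- by rewrite -gpredV invgM invgK.
- move=> xyG yzG; have := gpredM _ _ xyG yzG.
  by rewrite -mulgA mulVKg.
Qed.

Canonical coset_equiv := EquivRelPack coset_rel_equiv.

Definition coset_space := quotient_topology {eq_quot coset_rel}.
HB.instance Definition _ := PointedTopological.on coset_space.
HB.instance Definition _ := Quotient.on coset_space.

Definition coset_act (g : G) (q : coset_space) : coset_space :=
  \pi_coset_space (g * repr q)%g.

End Quotient.

Section Lattice.
Context {R : realType} {G : topologicalGroupType}.
Implicit Types (Gamma Lambda : groupClosed G).

Definition discrete_subgroup Gamma : Prop :=
  forall g, g \in Gamma -> isolated [set` Gamma] g.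

Definition lattice Gamma : Prop :=
  discrete_subgroup Gamma /\
  exists nu : {measure set (borel (coset_space Gamma)) -> \bar R},
    [/\ radon nu, (nu setT < +oo)%E, nu setT <> 0%E &
        forall (g : G) (A : set (borel (coset_space Gamma))), measurable A ->
          nu (coset_act g @^-1` A) = nu A].

Definition fundamental_domain Gamma (D : set (borel G)) : Prop :=
  measurable D /\
  forall x : G, exists! g : G, g \in Gamma /\ D (x * g)%g.

Definition is_covolume (mu : {measure set (borel G) -> \bar R}) Gamma
    (vol : \bar R) : Prop :=
  exists2 D, fundamental_domain Gamma D & vol = mu D.

Definition coset_representatives Gamma Lambda (X : set G) : Prop :=
  X `<=` [set` Gamma] /\
  forall g, g \in Gamma -> exists! x : G, X x /\ (x^-1 * g)%g \in Lambda.

End Lattice.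

(* Norms over R[i] take values in R[i]. *)
Definition rnorm {R : rcfType} {V : normedZmodType R[i]} (x : V) : R :=
  complex.Re `|x|.

HB.mixin Record CompleteNormedModule_isHilbert (R : realType) H
    of CompleteNormedModule R[i] H := {
  inner : {dot H for Num.conj};
  innerE : forall f : H, inner f f = `|f| ^+ 2 }.

#[short(type="hilbertType")]
HB.structure Definition Hilbert (R : realType) :=
  {H of CompleteNormedModule R[i] H & CompleteNormedModule_isHilbert R H}.

Section Families.
Context {R : realType} {H : hilbertType R} {T : choiceType}.
Implicit Types (I : set T) (g : T -> H).

Definition is_frame I g : Prop :=
  countable I /\
  exists A B : R, [/\ 0 < A, A <= B &
    forall f : H,
      ((A * rnorm f ^+ 2)%:E
        <= \esum_(i in I) (rnorm (inner f (g i)) ^+ 2)%:E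
        <= (B * rnorm f ^+ 2)%:E)%E].

(* Unconditional convergence of the family (g_i), i in I, to s. *)
Definition family_sum I g (s : H) : Prop :=
  forall e : R, 0 < e ->
    exists2 F0 : {fset T}, [set` F0] `<=` I &
      forall F : {fset T}, (F0 `<=` F)%fset -> [set` F] `<=` I ->
        rnorm (s - \sum_(i <- F) g i) < e.

Definition l2norm2 I (c : T -> R[i]) : \bar R :=
  \esum_(i in I) (rnorm (c i) ^+ 2)%:E.

Definition is_riesz_sequence I g : Prop :=
  countable I /\
  exists A B : R, [/\ 0 < A, A <= B &
    forall c : T -> R[i], (l2norm2 I c < +oo)%E ->
      exists2 s : H, family_sum I (fun i => c i *: g i) s &
        (A%:E * l2norm2 I c <= (rnorm s ^+ 2)%:E <= B%:E * l2norm2 I c)%E].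

End Families.

Section SigmaRepresentation.
Context {R : realType} {G : topologicalGroupType} {H : hilbertType R}.
Implicit Types (sigma : G -> G -> R[i]) (pi : G -> H -> H).

Definition unitary (U : H -> H) : Prop :=
  [/\ linear U, forall f g, inner (U f) (U g) = inner f g &
      forall g, exists f, U f = g].

Definition sigma_representation sigma pi : Prop :=
  [/\ forall x y, `|sigma x y| = 1,
      forall x, unitary (pi x),
      forall f, pi 1%g f = f,
      forall x y f, pi x (pi y f) = sigma x y *: pi (x * y)%g f &
      forall f g, measurable_fun setT
        (fun x : borel G => inner f (pi x g) : borel (R[i]^o))].

Definition closed_subspace (W : set H) : Prop :=
  [/\ closed W, W 0 & forall (a : R[i]) f g, W f -> W g -> W (a *: f + g)].

Definition irreducible pi : Prop :=
  forall W : set H, closed_subspace W ->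
    (forall x f, W f -> W (pi x f)) -> W = [set 0] \/ W = setT.

Definition coef_norm2 (mu : {measure set (borel G) -> \bar R}) pi
    (f eta : H) : \bar R :=
  (\int[mu]_x ((rnorm (inner f (pi x eta)) ^+ 2)%:E))%E.

Definition square_integrable mu pi : Prop :=
  exists2 eta : H, eta != 0 & (coef_norm2 mu pi eta eta < +oo)%E.

Definition discrete_series mu sigma pi : Prop :=
  [/\ sigma_representation sigma pi, irreducible pi & square_integrable mu pi].

Definition formal_dimension mu pi (d : R) : Prop :=
  0 < d /\ forall f eta : H,
    coef_norm2 mu pi f eta = (d^-1 * rnorm f ^+ 2 * rnorm eta ^+ 2)%:E.

End SigmaRepresentation.

(* Main.v *)
Require Import Defs.
From HB Require Import structures.
From mathcomp Require Import all_boot all_order all_algebra.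
From mathcomp Require Import finmap complex.
From mathcomp Require Import all_classical all_reals all_analysis.
From mathcomp Require Import measurable_realfun ring lra.

(* Let [q f] be the sum over Gamma of [|<f, pi(y) eta>|^2] and solve
   [S h + e h = eta] weakly, [S] being the frame operator of the orbit of [eta]
   and [e >= 0] a regularization ([e = 0] for a frame, [e > 0] for a Riesz
   sequence); [h] is the minimizer of [q f + e |f|^2 - 2 Re <f, eta>].  As [S]
   commutes with [pi(Gamma)],
     sum_y <f, pi(y) eta> <pi(y) h, f> = <(S + e)^-1 S f, f>,
   which equals [|f|^2] if [e = 0] and is at most [|f|^2] in general.  Integrating
   over a fundamental domain and using the orthogonality relations gives
   [<h, eta> = vol d] for a frame and [<h, eta> <= vol d] in general.
   The |Lambda| proportional orbit vectors give
   [|Lambda| <h, eta>^2 <= q h <= <h, eta>], so [<h, eta> <= 1/|Lambda|], which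
   is (i).  In the Riesz case the lower Riesz bound, applied to
   [eta - S h = e h], forces [<h, eta>] to tend to [1/|Lambda|] as [e -> 0],
   which is (ii). *)

Set Implicit Arguments.
Unset Strict Implicit.
Unset Printing Implicit Defensive.

Import Order.TTheory GRing.Theory Num.Theory.
Import numFieldNormedType.Exports.

Local Open Scope classical_set_scope.
Local Open Scope ring_scope.
Local Open Scope complex_scope.

(** * Hilbert spaces as real inner product spaces *)

Lemma rnorm_complexE (R : rcfType) (z : R[i]) :
  rnorm z ^+ 2 = complex.Re z ^+ 2 + complex.Im z ^+ 2.
Proof.
case: z => a b; rewrite /rnorm normc_def /= sqr_sqrtr //.
by rewrite addr_ge0 ?sqr_ge0.
Qed.

Lemma rnormE (R : rcfType) (V : normedZmodType R[i]) (f : V) :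
  (rnorm f)%:C = `|f|.
Proof. by rewrite /rnorm RRe_real // realE normr_ge0. Qed.

Section RealHilbert.
Context {R : realType} {H : hilbertType R}.
Implicit Types f g v w : H.

Definition rinner f g : R := complex.Re (inner f g).

Lemma innerDl f g v : inner (f + g) v = inner f v + inner g v.
Proof. by rewrite linearDl. Qed.

Lemma innerBl f g v : inner (f - g) v = inner f v - inner g v.
Proof. by rewrite linearBl. Qed.

Lemma innerDr f g v : inner v (f + g) = inner v f + inner v g.
Proof. by rewrite linearDr. Qed.

Lemma innerBr f g v : inner v (f - g) = inner v f - inner v g.
Proof. by rewrite linearBr. Qed.

Lemma innerZl (a : R[i]) f g : inner (a *: f) g = a * inner f g.
Proof. by rewrite linearZl_LR. Qed.

Lemma innerZr (a : R[i]) f g : inner f (a *: g) = a^* * inner f g.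
Proof. by rewrite linearZr_LR. Qed.

Lemma innerC f g : inner f g = (inner g f)^*.
Proof. by rewrite hermC /= expr0 mul1r. Qed.

Lemma rnorm_ge0 f : 0 <= rnorm f.
Proof. by have := normr_ge0 f; rewrite /rnorm lecE => /andP[_]. Qed.

Lemma rnorm2E f : rnorm f ^+ 2 = rinner f f.
Proof. by rewrite /rinner innerE -rnormE -rmorphXn. Qed.

Lemma rinnerC f g : rinner f g = rinner g f.
Proof. by rewrite /rinner innerC; case: (inner _ _). Qed.

Lemma rinnerDl f g v : rinner (f + g) v = rinner f v + rinner g v.
Proof. by rewrite /rinner innerDl raddfD. Qed.

Lemma rinnerBl f g v : rinner (f - g) v = rinner f v - rinner g v.
Proof. by rewrite /rinner innerBl raddfB. Qed.

Lemma rinnerDr f g v : rinner v (f + g) = rinner v f + rinner v g.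
Proof. by rewrite /rinner innerDr raddfD. Qed.

Lemma rinnerBr f g v : rinner v (f - g) = rinner v f - rinner v g.
Proof. by rewrite /rinner innerBr raddfB. Qed.

Lemma rinnerZl (t : R) f g : rinner (t%:C *: f) g = t * rinner f g.
Proof. by rewrite /rinner innerZl; case: (inner _ _) => a b /=; ring. Qed.

Lemma rinnerZr (t : R) f g : rinner g (t%:C *: f) = t * rinner g f.
Proof. by rewrite rinnerC rinnerZl rinnerC. Qed.

Lemma rnorm_eq0 f : (rnorm f == 0) = (f == 0).
Proof. by rewrite -[f == 0]normr_eq0 -rnormE (inj_eq (@complexI R)). Qed.

Lemma rinnerNl f g : rinner (- f) g = - rinner f g.
Proof. by rewrite /rinner linearNl raddfN. Qed.

Lemma rinnerNr f g : rinner f (- g) = - rinner f g.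
Proof. by rewrite rinnerC rinnerNl rinnerC. Qed.

Lemma rnormN f : rnorm (- f) = rnorm f.
Proof. by rewrite /rnorm normrN. Qed.

End RealHilbert.

(** * Minimization of coercive quadratic forms *)

Lemma le_of_small_slack (R : realFieldType) (x y C : R) :
  (forall t, 0 < t <= 1 -> x <= y + t * C) -> x <= y.
Proof.
move=> h; rewrite leNgt; apply/negP => yx.
have D0 : 0 < 1 + `|C| by rewrite ltr_wpDr.
have Dx : 0 < 1 + `|C| + (x - y) by rewrite addr_gt0// subr_gt0.
(* This choice makes [t * (1 + |C|) + t * (x - y)] equal to [x - y], hence [t * C < x - y], against
   the hypothesis. *)
pose t := (x - y) / (1 + `|C| + (x - y)).
have t01 : 0 < t <= 1.
  by rewrite divr_gt0 ?subr_gt0//= ler_pdivrMr// mul1r lerDr ltW.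
have tE : t * (1 + `|C| + (x - y)) = x - y by rewrite divfK ?gt_eqF.
have /andP[t0 t1] := t01; have := h t t01.
have : t * C <= t * `|C| by rewrite ler_wpM2l ?ler_norm// ltW.
have : 0 < t * (x - y) by rewrite mulr_gt0// subr_gt0.
by move: tE; rewrite !mulrDr mulr1 => *; lra.
Qed.

Section Quadratic.
Context {R : realType} {H : hilbertType R}.
Implicit Types f g v w : H.

Lemma rinner_young (t : R) f g : 0 < t ->
  2 * rinner f g <= t * rnorm f ^+ 2 + t^-1 * rnorm g ^+ 2.
Proof.
move=> t0; have := sqr_ge0 (rnorm (t%:C *: f - g)).
rewrite !rnorm2E rinnerBl !rinnerBr !rinnerZl !rinnerZr (rinnerC g f) => h.
rewrite -(ler_pM2l t0) mulrDr mulVKf ?gt_eqF//; lra.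
Qed.

(** A nonnegative quadratic form, described by relations whose coefficients are all nonnegative, so
    that each relation passes term by term to sums in [\bar R]. For this reason [t] is confined to
    [[0, 1]] in [quad_convex]. *)
Record quadratic (N : H -> R) : Prop := Quadratic {
  quad_ge0 : forall f, 0 <= N f;
  quad_parallelogram : forall f v, N (f + v) + N (f - v) = 2 * N f + 2 * N v;
  quad_convex : forall f v (t : R), 0 <= t <= 1 ->
    N (f + t%:C *: v) + t * (1 - t) * N v = (1 - t) * N f + t * N (f + v);
  quad_young : forall f v (t : R), 0 < t ->
    N (f + v) <= (1 + t) * N f + (1 + t^-1) * N v }.

Lemma rnorm_quadratic : quadratic (fun f => rnorm f ^+ 2).
Proof.
split=> [f|f v|f v t _|f v t t0]; rewrite ?sqr_ge0// !rnorm2E.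
- by rewrite !(rinnerBl, rinnerBr, rinnerDl, rinnerDr) (rinnerC v f); ring.
- rewrite !(rinnerDl, rinnerDr, rinnerZl, rinnerZr) (rinnerC v f); ring.
- rewrite !(rinnerDl, rinnerDr) (rinnerC v f).
  by have := rinner_young f v t0; rewrite !rnorm2E; lra.
Qed.

Lemma rnorm_complete (u : nat -> H) :
  (forall e : R, 0 < e ->
    exists n0, forall n, (n0 <= n)%N -> rnorm (u n0 - u n) < e) ->
  exists h, forall e : R, 0 < e ->
    exists n0, forall n, (n0 <= n)%N -> rnorm (h - u n) < e.
Proof.
have toC (e : R[i]) (f : H) : 0 < e -> (`|f| < e) = (rnorm f < complex.Re e).
  case: e => a b; rewrite ltcE /= => /andP[/eqP -> a0].
  by rewrite -rnormE ltcE /= eqxx.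
move=> uC; have /cauchy_cvg uc : cauchy (u @ \oo).
  apply: cauchy_exP => e e0.
  have [|n0 n0P] := uC (complex.Re e).
    by move: e0; rewrite ltcE => /andP[].
  exists (u n0); exists n0 => //= n /n0P.
  by rewrite -ball_normE /= toC.
have /cvgrPdist_lt uh : u @ \oo --> lim (u @ \oo) by [].
exists (lim (u @ \oo)) => e e0.
have [|n0 _ n0P] := uh e%:C; first by rewrite ltcR.
exists n0 => n /n0P /=; rewrite toC ?ltcR //.
Qed.

Section Minimizer.
Variables (N : H -> R) (A B : R) (g : H).
Hypotheses (qN : quadratic N) (A0 : 0 < A) (B0 : 0 <= B).
Hypothesis NA : forall f, A * rnorm f ^+ 2 <= N f.
Hypothesis NB : forall f, N f <= B * rnorm f ^+ 2.

Let J f := N f - 2 * rinner f g.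

Let J_lb : has_inf (range J).
Proof.
split; first by exists (J 0); exists 0.
exists (- (A^-1 * rnorm g ^+ 2)) => _ [f _ <-]; rewrite /J.
by have := rinner_young f g A0; have := NA f; lra.
Qed.

Let m := inf (range J).

Let mJ f : m <= J f.
Proof. by apply: ge_inf; [case: J_lb|exists f]. Qed.

(** The midpoint of two near-minimizers still has [J] at least [m]; the identity [quad_convex] at
    [t = 1/2] turns this into a bound on [N (v - f)]. *)
Let J_close f v (e1 e2 : R) : J f <= m + e1 -> J v <= m + e2 ->
  A * rnorm (v - f) ^+ 2 <= 2 * e1 + 2 * e2.
Proof.
move=> f1 v2; apply: (le_trans (NA _)).
have := mJ (f + (2^-1)%:C *: (v - f)); move: f1 v2; rewrite /J.
have /(quad_convex qN f (v - f)) : 0 <= (2^-1 : R) <= 1 by lra.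
rewrite (addrC f (v - f)) subrK rinnerDl rinnerZl rinnerBl; lra.
Qed.

Let min_seq : exists u : nat -> H, forall n, J (u n) <= m + n.+1%:R^-1.
Proof.
suff /choice[u uP] : forall n : nat, exists f, J f <= m + n.+1%:R^-1 by exists u.
move=> n; have /(inf_adherent)/(_ J_lb)[_ [f _ <-] /ltW] :
  0 < n.+1%:R^-1 :> R by rewrite invr_gt0.
by exists f.
Qed.

(** A minimizing sequence of [J] is Cauchy by [J_close], and its limit is a minimizer. The
    conclusion is the Euler equation there, a quarter of the left-hand side being the bilinear form
    of [N] at [(h, v)]. *)
Lemma quadratic_minimizer :
  exists h, forall v, N (h + v) - N (h - v) = 4 * rinner v g.
Proof.
have [u uJ] := min_seq.
have /rnorm_complete[h hu] : forall e : R, 0 < e ->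
    exists n0, forall n, (n0 <= n)%N -> rnorm (u n0 - u n) < e.
  move=> e e0; have : 0 < A * e ^+ 2 / 4 by rewrite divr_gt0 ?mulr_gt0 ?exprn_gt0.
  move=> /ltr_add_invr[n0]; rewrite add0r => n0e.
  exists n0 => n n0n; rewrite -(ltr_pXn2r (n := 2)) ?nnegrE ?rnorm_ge0 ?ltW//.
  rewrite -(ltr_pM2l A0); apply: (le_lt_trans (J_close (uJ n) (uJ n0))).
  have : n.+1%:R^-1 <= n0.+1%:R^-1 :> R by rewrite lef_pV2 ?posrE ?ler_nat.
  move: n0e; move: (A * e ^+ 2) (n.+1%:R^-1) (n0.+1%:R^-1) => a b c; lra.
have Jh : J h <= m.
  (* [N] is compared at [h] and at [f = u n] through [quad_young] with weight [d]. The error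
     [e = h - f] has norm below [d], so [N e / d] is of order [d], like all other errors; [C] adds
     up their constants. *)
  pose C := 2 + B * (2 * rnorm h ^+ 2 + 4) + rnorm g ^+ 2.
  apply: (@le_of_small_slack _ _ _ C) => d /andP[d0 d1].
  have [n1 n1P] := hu d d0; have [n2 n2d] := ltr_add_invr d0.
  pose n := maxn n1 n2; have := n1P n (leq_maxl _ _).
  have : J (u n) <= m + d.
    apply: le_trans (uJ n) _; rewrite lerD2l; apply: ltW; apply: le_lt_trans n2d.
    by rewrite add0r lef_pV2 ?posrE// ler_nat ltnS leq_maxr.
  set f := u n; set e := h - f => Jf ed.
  have fe : f + e = h by rewrite /e addrC subrK.
  have ed2 : rnorm e ^+ 2 <= d ^+ 2 by rewrite ler_pXn2r ?nnegrE ?rnorm_ge0 ?ltW.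
  have d2d : d ^+ 2 <= d by rewrite expr2 ler_piMl// ltW.
  have f2 : rnorm f ^+ 2 <= 2 * rnorm h ^+ 2 + 2.
    have := quad_parallelogram rnorm_quadratic h e.
    rewrite (_ : h - e = f); last by rewrite -fe addrK.
    have := sqr_ge0 (rnorm (h + e)); lra.
  have Nf : d * N f <= d * (B * (2 * rnorm h ^+ 2 + 2)).
    by rewrite ler_wpM2l ?(ltW d0)// (le_trans (NB f))// ler_wpM2l.
  have Ne : (1 + d^-1) * N e <= d * (2 * B).
    apply: (@le_trans _ _ ((1 + d^-1) * (B * d ^+ 2))).
      rewrite ler_wpM2l ?addr_ge0 ?invr_ge0 ?(ltW d0)//.
      by rewrite (le_trans (NB e))// ler_wpM2l.
    have -> : (1 + d^-1) * (B * d ^+ 2) = B * (d ^+ 2 + d).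
      by rewrite mulrDl mul1r expr2; field; rewrite gt_eqF.
    by have := ler_wpM2l B0 d2d; lra.
  have re : - (2 * rinner e g) <= d + d * rnorm g ^+ 2.
    rewrite -mulrN -rinnerNr (rinnerC e).
    apply: le_trans (rinner_young _ _ d0) _; rewrite addrC.
    by rewrite rnormN lerD2r ler_pdivrMl.
  have := quad_young qN f e d0; rewrite fe.
  have rh : rinner h g = rinner f g + rinner e g by rewrite -rinnerDl fe.
  by move: Jf; rewrite /J /= ?rh /C; move: re Nf Ne; lra.
exists h.
(* First variation: minimality against [h + t v], expanded by [quad_convex] and divided by [t],
   leaves the slack [t * N v]. *)
have var v : 2 * rinner v g <= N (h + v) - N h - N v.
  apply: (@le_of_small_slack _ _ _ (N v)) => t /andP[t0 t1].
  have := le_trans Jh (mJ (h + t%:C *: v)); rewrite /J rinnerDl rinnerZl.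
  have /(quad_convex qN h v) : 0 <= t <= 1 by rewrite t1 ltW.
  move=> c1 c2; rewrite -(ler_pM2l t0).
  by move: c1 c2; rewrite /J /=; lra.
(* By the parallelogram law the right-hand sides of [var] at [v] and at [- v] are opposite, so both
   bounds are equalities. *)
move=> v; have := quad_parallelogram qN h v; have := var v; have := var (- v).
have -> : N (- v) = N v.
  have := quad_parallelogram qN 0 v; have := quad_parallelogram qN 0 0.
  by rewrite subr0 !add0r; lra.
by rewrite rinnerNl; lra.
Qed.

End Minimizer.
End Quadratic.

(** * Sums of quadratic forms *)

Lemma esumZ (R : realType) (T : choiceType) (I : set T) (a : T -> \bar R) (c : R) :
  0 <= c -> (forall i, I i -> 0 <= a i)%E ->
  (\esum_(i in I) (c%:E * a i) = c%:E * \esum_(i in I) a i)%E.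
Proof.
have le (b : T -> \bar R) (s : R) : 0 <= s -> (forall i, I i -> 0 <= b i)%E ->
    (\esum_(i in I) (s%:E * b i) <= s%:E * \esum_(i in I) b i)%E.
  move=> s0 b0; apply: ge_ereal_sup => _ [X [finX XI] <-].
  rewrite fsbig_finite// big_seq -ge0_sume_distrr; last first.
    by move=> i; rewrite in_fset_set// inE => /XI/b0.
  rewrite -big_seq -fsbig_finite// lee_wpmul2l ?lee_fin// esum_ge//.
  by exists X.
rewrite le_eqVlt => /predU1P[<- a0|c0 a0].
  by rewrite mul0e esum1// => i _; rewrite mul0e.
apply/le_anti/andP; split; first by apply: le => //; exact: ltW.
rewrite -lee_pdivlMl//.
rewrite [leLHS](_ : _ = \esum_(i in I) (c^-1%:E * (c%:E * a i)))%E; last first.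
  by apply: eq_esum => i _; rewrite muleA -EFinM mulVf ?mul1e// gt_eqF.
by apply: le => [|i Ii]; rewrite ?invr_ge0 ?mule_ge0 ?lee_fin ?a0// ltW.
Qed.

Section QuadraticSums.
Context {R : realType} {H : hilbertType R}.
Implicit Types f g v w : H.

Lemma quadratic_inner g : quadratic (fun f => rnorm (inner f g) ^+ 2).
Proof.
split=> [f|f v|f v t _|f v t t0]; rewrite ?sqr_ge0// ?(innerBl, innerDl, innerZl);
  rewrite !rnorm_complexE; move: (inner f g) (inner v g) => [a b] [c d] /=.
- by ring.
- by ring.
have y (x z : R) : (x + z) ^+ 2 <= (1 + t) * x ^+ 2 + (1 + t^-1) * z ^+ 2.
  have : 0 <= t^-1 * (t * x - z) ^+ 2 by rewrite mulr_ge0 ?sqr_ge0 ?invr_ge0 ?ltW.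
  have -> : t^-1 * (t * x - z) ^+ 2 = t * x ^+ 2 - 2 * x * z + t^-1 * z ^+ 2.
    by field; rewrite gt_eqF.
  lra.
by have := y a c; have := y b d; lra.
Qed.

Lemma quadraticDZ (N1 N2 : H -> R) (c : R) : 0 <= c ->
  quadratic N1 -> quadratic N2 -> quadratic (fun f => N1 f + c * N2 f).
Proof.
move=> c0 [a1 b1 d1 y1] [a2 b2 d2 y2]; split=> [f|f v|f v t t01|f v t t0].
- by rewrite addr_ge0 ?mulr_ge0.
- by move: (b1 f v) (b2 f v) => e1 e2; nra.
- by move: (d1 f v t t01) (d2 f v t t01) => e1 e2; nra.
- by move: (y1 f v t t0) (ler_wpM2l c0 (y2 f v t t0)); lra.
Qed.

Lemma quadratic_esum (T : choiceType) (I : set T) (t : T -> H -> R) (N : H -> R) :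
  (forall i, I i -> quadratic (t i)) ->
  (forall f, \esum_(i in I) (t i f)%:E = (N f)%:E) ->
  quadratic N.
Proof.
move=> qt tN.
have t0 i f : I i -> 0 <= t i f by move=> /qt/quad_ge0.
have comb f v (a b : R) : 0 <= a -> 0 <= b ->
    \esum_(i in I) (a * t i f + b * t i v)%:E = (a * N f + b * N v)%:E.
  move=> a0 b0; rewrite EFinD !EFinM -!tN -!esumZ//; try by move=> i Ii; rewrite lee_fin t0.
  by rewrite -esumD// => i Ii; rewrite lee_fin mulr_ge0 ?t0.
split=> [f|f v|f v s /andP[s0 s1]|f v s s0].
- by rewrite -lee_fin -tN esum_ge0// => i Ii; rewrite lee_fin t0.
- apply: EFin_inj; rewrite -[N (f + v)]mul1r -[N (f - v)]mul1r -!comb//.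
  by apply: eq_esum => i /qt/quad_parallelogram => e; rewrite !mul1r e.
- apply: EFin_inj; rewrite -[N (f + _)]mul1r -!comb ?mulr_ge0 ?subr_ge0//.
  by apply: eq_esum => i /qt/quad_convex => e; rewrite mul1r e// s0.
- rewrite -lee_fin -tN -comb ?addr_ge0 ?invr_ge0 ?(ltW s0)//.
  by apply: le_esum => i /qt/quad_young/(_ _ _ _ s0); rewrite lee_fin.
Qed.

End QuadraticSums.

(** * The frame operator of an orbit *)

Section OrbitSums.
Context {R : realType} {G : topologicalGroupType} {H : hilbertType R}.
Variables (sigma : G -> G -> R[i]) (pi : G -> H -> H).
Hypothesis rep : sigma_representation sigma pi.
Implicit Types (f g v a : H) (Gamma : groupClosed G).

Definition orbit_sum Gamma f a : \bar R :=
  \esum_(x in [set` Gamma]) (rnorm (inner f (pi x a)) ^+ 2)%:E.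

Lemma repD x f g : pi x (f + g) = pi x f + pi x g.
Proof.
by case: rep => _ /(_ x)[+ _ _ _ _ _] => /(_ 1 f g); rewrite !scale1r.
Qed.

Lemma rep0 x : pi x 0 = 0.
Proof. by apply: (@addrI _ (pi x 0)); rewrite -repD !addr0. Qed.

Lemma repN x f : pi x (- f) = - pi x f.
Proof. by apply/eqP; rewrite -addr_eq0 -repD addNr rep0. Qed.

Lemma repB x f g : pi x (f - g) = pi x f - pi x g.
Proof. by rewrite repD repN. Qed.

Lemma repZ x (c : R[i]) f : pi x (c *: f) = c *: pi x f.
Proof.
case: rep => _ /(_ x)[+ _ _ _ _ _] => /(_ c f 0).
by rewrite !addr0 rep0 addr0.
Qed.

Lemma rep_inner x f g : inner (pi x f) (pi x g) = inner f g.
Proof. by case: rep => _ /(_ x)[]. Qed.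

Lemma rep_surj x g : exists f, pi x f = g.
Proof. by case: rep => _ /(_ x)[]. Qed.

Lemma rep_rnorm x f : rnorm (pi x f) ^+ 2 = rnorm f ^+ 2.
Proof. by rewrite !rnorm2E /rinner rep_inner. Qed.

Lemma rnormM (z w : R[i]) : rnorm (z * w) = rnorm z * rnorm w.
Proof.
apply: (@complexI R); rewrite rmorphM /=.
by rewrite /rnorm !RRe_real ?realE ?normr_ge0// normrM.
Qed.

Lemma rnorm_conj (z : R[i]) : rnorm z^* = rnorm z.
Proof. by rewrite /rnorm norm_conjC. Qed.

Lemma rnorm_innerC f g : rnorm (inner f g) = rnorm (inner g f).
Proof. by rewrite innerC rnorm_conj. Qed.

Lemma rnorm_inner_repM x y f a :
  rnorm (inner f (pi x (pi y a))) = rnorm (inner f (pi (x * y)%g a)).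
Proof.
case: rep => s1 _ _ -> _.
rewrite innerZr rnormM rnorm_conj.
by rewrite [rnorm (sigma x y)]/rnorm s1 /= mul1r.
Qed.

Lemma rnorm_inner_repV x y f a :
  rnorm (inner (pi x f) (pi y a)) = rnorm (inner f (pi (x^-1 * y)%g a)).
Proof.
by rewrite -(rep_inner x f) rnorm_inner_repM mulVKg.
Qed.

Lemma orbit_sum_ge0 Gamma f a : (0 <= orbit_sum Gamma f a)%E.
Proof. by apply: esum_ge0 => x _; rewrite lee_fin sqr_ge0. Qed.

(** The cocycle has modulus one and drops out of absolute values, so moving [pi y] to the other side
    only translates the index set [Gamma]. *)
Lemma orbit_sum_rep Gamma y f a : y \in Gamma ->
  orbit_sum Gamma (pi y f) a = orbit_sum Gamma f a.
Proof.
move=> yG; rewrite /orbit_sum [RHS](reindex_esum [set` Gamma] _ (fun x => y^-1 * x)%g).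
  by apply: eq_esum => x _; rewrite rnorm_inner_repV.
split.
- by move=> x /= xG; rewrite gpredM ?gpredV.
- by move=> u v _ _ /mulgI.
- by move=> x /= xG; exists (y * x)%g; rewrite /= ?gpredM ?mulKg.
Qed.

Section Dual.
Variables (Gamma : groupClosed G) (eta : H) (q : H -> R) (e A B : R).
Hypothesis qE : forall f, orbit_sum Gamma f eta = (q f)%:E.
Hypotheses (e0 : 0 <= e) (A0 : 0 < A) (B0 : 0 <= B).
Hypothesis qA : forall f, A * rnorm f ^+ 2 <= q f + e * rnorm f ^+ 2.
Hypothesis qB : forall f, q f <= B * rnorm f ^+ 2.

Let N f := q f + e * rnorm f ^+ 2.

Lemma orbit_quadratic : quadratic q.
Proof.
by apply: (quadratic_esum (fun x _ => quadratic_inner (pi x eta))) => f; rewrite -qE.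
Qed.

Let qN : quadratic N.
Proof. exact: quadraticDZ e0 orbit_quadratic rnorm_quadratic. Qed.

Let solve g : exists h, forall v, N (h + v) - N (h - v) = 4 * rinner v g.
Proof.
apply: (@quadratic_minimizer _ _ N A (B + e)) => //; first by rewrite addr_ge0.
by move=> f; rewrite /N mulrDl lerD2r.
Qed.

Let N_rep y f : y \in Gamma -> N (pi y f) = N f.
Proof.
move=> yG; rewrite /N rep_rnorm; congr (_ + _); apply: EFin_inj.
by rewrite -!qE orbit_sum_rep.
Qed.

Let NZ (c : R[i]) f : `|c| = 1 -> N (c *: f) = N f.
Proof.
have rc (z : R[i]) : `|c| = 1 -> rnorm (c * z) = rnorm z.
  by move=> c1; rewrite rnormM [rnorm c]/rnorm c1 mul1r.
move=> c1; rewrite /N /rnorm normrZ c1 mul1r; congr (_ + _).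
apply: EFin_inj; rewrite -!qE; apply: eq_esum => x _.
by rewrite innerZl rc.
Qed.

Let NN f : N (- f) = N f.
Proof. by rewrite -scaleN1r NZ// normrN1. Qed.

(* The inverse of the frame operator commutes with [pi y]: a solution operator
   [g |-> k] is self-adjoint and invariant, which is tested here against the
   polarization of [N] along [v] and [i v]. *)
Let dual_inner y g k h : y \in Gamma ->
  (forall v, N (k + v) - N (k - v) = 4 * rinner v g) ->
  (forall v, N (h + v) - N (h - v) = 4 * rinner v eta) ->
  inner (pi y h) g = inner (pi y eta) k.
Proof.
move=> yG kP hP.
have key (c : R[i]) : `|c| = 1 ->
    complex.Re (c * inner (pi y h) g) = complex.Re (c * inner (pi y eta) k).
  (* [w] is chosen so that [pi y (h + w)] is [c^*] times [k + c *: pi y h]. The equation of [h]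
     along [w] and that of [k] along [c *: pi y h] then have the same left-hand side. *)
  move=> c1; have [w wk] := rep_surj y (c^* *: k).
  have c1' : `|c^*| = 1 by rewrite norm_conjC.
  have := kP (c *: pi y h); have := hP w.
  rewrite -[N (h + w)](N_rep _ yG) -[N (h - w)](N_rep _ yG) repD repB wk.
  have cc : c^* * c = 1 by rewrite mulrC -normCK c1 expr1n.
  rewrite -[N (k + _)](NZ _ c1') -[N (k - _)](NZ _ c1').
  rewrite scalerDr scalerBr scalerA cc scale1r.
  rewrite [_ + c^* *: k]addrC -[N (pi y h - _)]NN opprB => e1 e2.
  have -> : complex.Re (c * inner (pi y h) g) = rinner w eta.
    by rewrite -innerZl; apply: (@mulfI _ 4); rewrite ?pnatr_eq0// -e1 -e2.
  by rewrite /rinner -(rep_inner y) wk innerZl innerC -rmorphM; case: (c * _).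
have r1 := key 1 (normr1 _); have := key 'i%C (normCi _).
move: r1; case: (inner _ g) (inner _ k) => [a b] [c d] /=.
by rewrite !mul1r !mul0r !subr0 !add0r => -> => bd; congr (_ +i* _); lra.
Qed.

(** The last clause is the polarized form of the identity for the sum of
    [<g, pi(y) eta> <pi(y) h, g>]: sums of nonnegative terms on both sides replace a series of
    products. Here [r] is [<(S + e)^-1 g, g>]. *)
Lemma orbit_dual : exists h,
  [/\ forall v, N (h + v) - N (h - v) = 4 * rinner v eta,
      N h = rinner h eta &
      forall g, exists2 r, 0 <= r &
        (orbit_sum Gamma g (eta + h)%R + (4 * e * r)%:E =
         orbit_sum Gamma g (eta - h)%R + (4 * rnorm g ^+ 2)%:E)%E].
Proof.
have N2 f : N (f + f) = 4 * N f.
  have := quad_parallelogram qN f f; have := quad_parallelogram qN 0 0.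
  by rewrite !subrr addr0; lra.
have NN0 : N 0 = 0 by have := N2 0; rewrite addr0; lra.
have [h hP] := solve eta; exists h; split=> //.
  by have := hP h; rewrite subrr NN0 N2; lra.
move=> g; have [k kP] := solve g; exists (rinner k g).
  have := kP k; rewrite subrr NN0 N2 => kg.
  by have := quad_ge0 qN k; lra.
(* By [dual_inner], testing the orbit of [h] on [g] is testing the orbit of [eta] on [k]; so
   [eta + h] against [g] becomes [eta] against [k + g]. *)
have -> : orbit_sum Gamma g (eta + h) = (q (k + g))%:E.
  rewrite -qE; apply: eq_esum => y yG; rewrite rnorm_innerC repD innerDl.
  by rewrite (dual_inner yG kP hP) -innerDr addrC rnorm_innerC.
have -> : orbit_sum Gamma g (eta - h) = (q (k - g))%:E.
  rewrite -qE; apply: eq_esum => y yG; rewrite rnorm_innerC repB innerBl.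
  rewrite (dual_inner yG kP hP) -innerBr rnorm_innerC -opprB linearNl.
  by rewrite /rnorm normrN.
rewrite -!EFinD; congr EFin.
have := kP g; rewrite /N !rnorm2E !(rinnerBl, rinnerBr, rinnerDl, rinnerDr).
by rewrite (rinnerC g k); lra.
Qed.

End Dual.
End OrbitSums.

(** * Borel and Haar measures *)

Section CountableSums.
Context d (T : measurableType d) (R : realType) (mu : {measure set T -> \bar R}).
Context (I : pointedType) (J : set I) (f : I -> T -> \bar R).
Hypotheses (cJ : countable J) (mf : forall i, J i -> measurable_fun setT (f i)).
Hypothesis f0 : forall i x, (0 <= f i x)%E.

(** An injection of [J] into [nat], with zero terms outside its image, turns the sums into series,
    to which monotone convergence applies. *)
Let series_enum : exists u : nat -> T -> \bar R,
  [/\ forall n, measurable_fun setT (u n), forall n x, (0 <= u n x)%E,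
      forall x, (\esum_(i in J) f i x = \sum_(0 <= n <oo) u n x)%E &
      (\esum_(i in J) \int[mu]_x f i x = \sum_(0 <= n <oo) \int[mu]_x u n x)%E].
Proof.
have /countable_injP[j jI] := cJ.
pose e := pinv J j.
have eP n : n \in j @` J -> J (e n).
  by rewrite inE => -[i Ji <-]; rewrite /e pinvKV ?inE.
have enum (a : I -> \bar R) : (forall i, 0 <= a i)%E ->
    (\esum_(i in J) a i = \sum_(0 <= n <oo) if n \in j @` J then a (e n) else 0)%E.
  move=> a0; rewrite nneseries_esumT -?esum_mkcond; last by move=> n; case: ifP.
  rewrite esum_image//.
  by apply: eq_esum => i Ji; rewrite /e pinvKV ?inE.
exists (fun n x => if n \in j @` J then f (e n) x else 0%E); split.
- by move=> n; case: (boolP (n \in _)) => [/eP/mf//|_]; exact: measurable_cst.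
- by move=> n x; case: ifP.
- by move=> x; rewrite enum.
- rewrite enum => [|i]; last by apply: integral_ge0 => x _.
  by apply: eq_eseriesr => n _; case: ifP => // _; rewrite integral0.
Qed.

Lemma measurable_fun_esum : measurable_fun setT (fun x => \esum_(i in J) f i x)%E.
Proof.
have [u [mu0 u0 uE _]] := series_enum.
under eq_fun do rewrite uE.
exact: ge0_emeasurable_sum.
Qed.

Lemma integral_esum :
  (\int[mu]_x (\esum_(i in J) f i x) = \esum_(i in J) \int[mu]_x f i x)%E.
Proof.
have [u [mu0 u0 uE ->]] := series_enum.
under eq_integral do rewrite uE.
by rewrite integral_nneseries.
Qed.

End CountableSums.

Section BorelProducts.
Context {G G' : topologicalGroupType}.

Lemma borel_measurable_open (U : set G) : open U -> measurable (U : set (borel G)).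
Proof. exact: sub_sigma_algebra. Qed.

Lemma continuous_borel_measurable (f : G -> G') : continuous f ->
  measurable_fun setT (f : borel G -> borel G').
Proof.
move=> /continuousP fc.
apply: (@measurability _ _ (borel G) (borel G') setT f (@open G')) => //.
move=> _ [U oU <-].
by rewrite setTI; apply: borel_measurable_open; exact: fc.
Qed.

Hypothesis scG : @second_countable G.

(** By second countability an open set of [G * G] is a countable union of basic rectangles, and so
    lies in the product of the Borel sigma-algebras. *)
Lemma measurable_open_prod (U : set (G * G)) : open U ->
  measurable (U : set (borel G * borel G)).
Proof.
have [B cB [Bo Bb]] := scG => oU.
pose P := [set V : set G * set G | [/\ B V.1, B V.2 & V.1 `*` V.2 `<=` U]].
have -> : U = \bigcup_(V in P) (V.1 `*` V.2).
  apply/seteqP; split => [[x y] Uxy|z [V [_ _ VU]] /VU //].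
  have : nbhs (x, y) U by exact: open_nbhs_nbhs.
  move=> [[V W] [/= Vx Wy] VWU].
  have [V' [BV' V'x] V'V] := Bb x V Vx; have [W' [BW' W'y] W'W] := Bb y W Wy.
  exists (V', W') => //; split=> // -[a b] [/= V'a W'b]; apply: VWU.
  by split; [exact: V'V|exact: W'W].
have cP : countable P.
  apply: (@sub_countable _ _ _ (B `*` B)); last exact: countableX.
  by apply: subset_card_le => V [].
have /countable_injP[u injf] := cP.
rewrite -(injpinv_image (fun=> point) injf) bigcup_image.
apply: bigcup_measurable => _ [V PV <-]; rewrite pinvKV ?inE//.
have [BV1 BV2 _] := PV.
by apply: measurableX; apply: borel_measurable_open; apply: Bo.
Qed.

Lemma continuous_borel2_measurable (f : G * G -> G') : continuous f ->
  measurable_fun setT (f : borel G * borel G -> borel G').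
Proof.
move=> /continuousP fc.
apply: (@measurability _ _ (borel G * borel G)%type (borel G') setT f
  (@open G')) => // _ [U oU <-].
by rewrite setTI; apply: measurable_open_prod; exact: fc.
Qed.

End BorelProducts.

Lemma measurable_rnorm (R : realType) :
  measurable_fun setT (@rnorm R (R[i]^o) : borel (R[i]^o) -> R).
Proof.
apply: (@measurability _ _ (borel (R[i]^o)) R setT _ (@RGenInftyO.G R)).
  exact: RGenInftyO.measurableE.
move=> _ [_ [x ->] <-]; rewrite setTI.
suff -> : @rnorm R (R[i]^o) @^-1` `]-oo, x[ = ball (0 : R[i]^o) x%:C.
  by apply: sub_sigma_algebra; exact: ball_open.
apply/seteqP; split=> z /=; rewrite in_itv /= -ball_normE /= sub0r normrN.
  by rewrite -rnormE ltcR.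
by rewrite -rnormE ltcR.
Qed.

Lemma sigma_finite_tonelli d (T : measurableType d) (R : realType)
    (mu : {measure set T -> \bar R}) (f : T * T -> \bar R) :
  sigma_finite setT mu -> measurable_fun setT f -> (forall p, 0 <= f p)%E ->
  (\int[mu]_x \int[mu]_y f (x, y) = \int[mu]_y \int[mu]_x f (x, y))%E.
Proof.
move=> sf mf f0.
pose sfin := isSFinite.Build _ _ _ _ (sfinite_measure_sigma_finite sf).
pose sigmafin := isSigmaFinite.Build _ _ _ _ sf.
pose m := HB.pack_for (SigmaFiniteMeasure.type T R) (Measure.sort mu) sfin sigmafin.
exact: (@fubini_tonelli _ _ _ _ _ m m).
Qed.

Section ContinuousOperations.
Context {T : topologicalType} {G : topologicalGroupType}.

Lemma continuous_mulg (f g : T -> G) : continuous f -> continuous g ->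
  continuous (fun x => f x * g x)%g.
Proof.
move=> fc gc x.
apply: (@continuous_comp _ _ _ (fun x => (f x, g x)) (fun p => p.1 * p.2)%g x).
  by apply: cvg_pair; [exact: fc|exact: gc].
exact: mulg_continuous.
Qed.

Lemma continuous_invg (f : T -> G) : continuous f -> continuous (fun x => (f x)^-1)%g.
Proof.
move=> fc x; apply: (@continuous_comp _ _ _ f (fun y => y^-1)%g x); first exact: fc.
exact: invg_continuous.
Qed.

End ContinuousOperations.

Section HaarMeasure.
Context {R : realType} {G : topologicalGroupType}.
Variable mu : {measure set (borel G) -> \bar R}.
Hypotheses (hG : hausdorff_space G) (scG : @second_countable G).
Hypothesis haar : haar_measure mu.

(** Points are compact, so outer regularity puts each in an open set of finite measure; hence the
    countably many basic sets of finite measure cover [G]. *)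
Lemma haar_sigma_finite : sigma_finite setT mu.
Proof.
have [[muK muO _] _ _] := haar; have [B cB [Bo Bb]] := scG.
pose P := [set V : set G | B V /\ (mu V < +oo)%E].
have /countable_injP[u uI] : countable P.
  by apply: sub_countable cB; apply: subset_card_le => V [].
pose e := 'pinv_(fun=> set0) P u.
exists (fun m => if m \in u @` P then e m else set0).
  apply/seteqP; split=> // x _.
  have x1 : measurable ([set x] : set (borel G)).
    rewrite -[[set x]]setCK; apply: measurableC; apply: borel_measurable_open.
    apply: closed_openC; apply: accessible_closed_set1; exact: hausdorff_accessible.
  have := muK [set x] (@compact_set1 _ (x : G)).
  rewrite muO// => /ereal_inf_lt[_ [U [oU xU] <-] Uoo].
  have [|V [BV Vx] VU] := Bb x U; first by apply: open_nbhs_nbhs; split=> //; exact: xU.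
  have PV : P V.
    split=> //; apply: le_lt_trans Uoo; apply: le_measure => //; rewrite inE.
      by apply: borel_measurable_open; exact: Bo.
    exact: borel_measurable_open.
  exists (u V) => //=; rewrite ifT; last by rewrite inE; exists V.
  by rewrite /e pinvKV// inE.
move=> m; case: (boolP (m \in _)); last by rewrite measure0.
rewrite inE => -[V PV <-]; rewrite /e pinvKV ?inE//; case: (PV) => BV Voo; split=> //.
by apply: borel_measurable_open; exact: Bo.
Qed.

Lemma measurable_lmul (g : G) : measurable_fun setT ((fun x => g * x)%g : borel G -> borel G).
Proof.
by apply: continuous_borel_measurable; apply: continuous_mulg => x; [exact: cvg_cst|exact: cvg_id].
Qed.

Lemma haar_integral_lmul (g : G) (f : borel G -> \bar R) :
  measurable_fun setT f -> (forall x, 0 <= f x)%E ->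
  (\int[mu]_x f (g * x)%g = \int[mu]_x f x)%E.
Proof.
move=> mf f0; have [_ _ inv] := haar.
have := @ge0_integral_pushforward _ _ _ _ R _ (measurable_lmul g) mu setT f measurableT mf.
rewrite preimage_setT => <- //.
apply: eq_measure_integral => [|? A mA _]; first exact: measurable_lmul.
exact: inv.
Qed.

Context {H : hilbertType R}.
Variables (sigma : G -> G -> R[i]) (pi : G -> H -> H) (d : R).
Hypotheses (rep : sigma_representation sigma pi) (fdim : formal_dimension mu pi d).

Lemma measurable_coef (f g : H) :
  measurable_fun setT (fun x : borel G => (rnorm (inner f (pi x g)) ^+ 2)%:E).
Proof.
case: rep => _ _ _ _ m; apply/measurable_EFinP; apply: measurable_funX.
exact: (measurableT_comp (@measurable_rnorm R) (m f g)).
Qed.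

(* If [F x = |<eta, pi x eta>|^2], every right translate of [F] has the same
   finite nonzero integral [C]; integrating [1_E(y) F(x y)] over [G x G] in both
   orders gives [C mu(E) = C mu(E^-1)]. *)
Lemma haar_inv (eta : H) (E : set G) : eta != 0 -> measurable (E : set (borel G)) ->
  mu [set x : G | E (x^-1)%g] = mu E.
Proof.
move=> eta0 mE; have [d0 dE] := fdim; have [_ _ inv] := haar.
pose F (x : borel G) : \bar R := (rnorm (inner eta (pi x eta)) ^+ 2)%:E.
have F0 x : (0 <= F x)%E by rewrite lee_fin sqr_ge0.
have mF : measurable_fun setT F by exact: measurable_coef.
pose I (x : borel G) : \bar R := (\1_E x)%:E.
have I0 x : (0 <= I x)%E by rewrite lee_fin.
have mI : measurable_fun setT I by apply/measurable_EFinP; exact: measurable_indic.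
pose C := d^-1 * rnorm eta ^+ 2 * rnorm eta ^+ 2.
have C0 : 0 < C.
  by rewrite !mulr_gt0 ?invr_gt0 ?exprn_gt0// lt0r rnorm_ge0 rnorm_eq0 eta0.
have mmul : measurable_fun setT ((fun p => p.1 * p.2)%g : borel G * borel G -> borel G).
  apply: continuous_borel2_measurable => //.
  by apply: continuous_mulg => x; [exact: cvg_fst|exact: cvg_snd].
have minv : measurable_fun setT ((fun p => p.1^-1 * p.2)%g : borel G * borel G -> borel G).
  apply: continuous_borel2_measurable => //.
  apply: continuous_mulg => [|x]; last exact: cvg_snd.
  by apply: continuous_invg => x; exact: cvg_fst.
(* A right translation replaces [eta] by [pi y eta], of the same norm, in the orthogonality
   relations. *)
have Fy (y : G) : (\int[mu]_x F (x * y)%g = C%:E)%E.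
  have -> : C = d^-1 * rnorm eta ^+ 2 * rnorm (pi y eta) ^+ 2 by rewrite (rep_rnorm rep).
  rewrite -dE; apply: eq_integral => x _.
  by rewrite (rnorm_inner_repM rep).
have mlm (g : G) : measurable_fun setT ((fun x => g * x)%g : borel G -> borel G).
  exact: measurable_lmul.
have mrm (g : G) : measurable_fun setT ((fun x => x * g)%g : borel G -> borel G).
  apply: continuous_borel_measurable.
  by apply: continuous_mulg => x; [exact: cvg_id|exact: cvg_cst].
have E1 : (\int[mu]_y \int[mu]_x (I y * F (x * y)%g) = C%:E * mu E)%E.
  transitivity (\int[mu]_y (I y * C%:E))%E.
    apply: eq_integral => y _; rewrite ge0_integralZl// ?Fy//.
    exact: (measurableT_comp mF (mrm y)).
  by rewrite ge0_integralZr// ?lee_fin ?ltW// integral_indic// setIT muleC.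
have E2 (x : G) : (\int[mu]_y (I y * F (x * y)%g) = \int[mu]_y (I (x^-1 * y)%g * F y))%E.
  rewrite -[RHS](haar_integral_lmul x).
  - by apply: eq_integral => y _; rewrite mulKg.
  - by apply: emeasurable_funM => //; exact: (measurableT_comp mI (mlm _)).
  - by move=> y; rewrite mule_ge0.
have minvg : measurable_fun setT ((fun x => x^-1)%g : borel G -> borel G).
  by apply: continuous_borel_measurable; exact: invg_continuous.
have mEV : measurable ([set x : G | E (x^-1)%g] : set (borel G)).
  by have := minvg measurableT E mE; rewrite setTI.
(* For fixed [y], the points [x] with [x^-1 y] in [E] form the left translate [y E^-1]. *)
have E3 (y : G) : (\int[mu]_x (I (x^-1 * y)%g * F y)
    = mu [set x : G | E (x^-1)%g] * F y)%E.
  have mV : measurable_fun setT ((fun x => x^-1 * y)%g : borel G -> borel G).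
    exact: (measurableT_comp (mrm y) minvg).
  rewrite ge0_integralZr//; last exact: (measurableT_comp mI mV).
  congr (_ * _)%E; rewrite -(inv y^-1%g)//.
  have mA : measurable ([set x : G | E (x^-1 * y)%g] : set (borel G)).
    by have := mV measurableT E mE; rewrite setTI.
  transitivity (\int[mu]_x (\1_[set x : G | E (x^-1 * y)%g] x)%:E)%E.
    by apply: eq_integral => x _; rewrite /I !indicE;
      congr ((_ : bool)%:R%:E); apply/idP/idP; rewrite !inE.
  rewrite integral_indic// setIT; congr (mu _); apply/seteqP.
  by split=> x /=; rewrite invgM invgK.
have : (C%:E * mu E = C%:E * mu [set x : G | E (x^-1)%g])%E.
  rewrite -E1 -(sigma_finite_tonelli
    (f := fun p : borel G * borel G => I p.2 * F (p.1 * p.2)%g)%E) /=; last 3 first.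
  - exact: haar_sigma_finite.
  - by apply: emeasurable_funM; [exact: measurableT_comp|exact: (measurableT_comp mF mmul)].
  - by move=> p; rewrite mule_ge0.
  under eq_integral do rewrite E2.
  rewrite (sigma_finite_tonelli
    (f := fun p : borel G * borel G => I (p.1^-1 * p.2)%g * F p.2)%E) /=; last 3 first.
  - exact: haar_sigma_finite.
  - by apply: emeasurable_funM; [exact: (measurableT_comp mI minv)|exact: measurableT_comp].
  - by move=> p; rewrite mule_ge0.
  under eq_integral do rewrite E3.
  rewrite ge0_integralZl// muleC; congr (_ * _)%E.
  by rewrite /C -dE.
move=> /(congr1 (fun z => C^-1%:E * z)%E).
by rewrite !muleA -EFinM mulVf ?mul1e// gt_eqF.
Qed.

End HaarMeasure.

(** * Unfolding matrix coefficients along a lattice *)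

Lemma esum_unique (R : realType) (T : choiceType) (I : set T) (a : T -> \bar R) (t : T) :
  I t -> (forall i, 0 <= a i)%E -> (forall i, I i -> i <> t -> a i = 0%E) ->
  (\esum_(i in I) a i = a t)%E.
Proof.
move=> It a0 at0; rewrite (esumID [set t])//.
have -> : I `&` [set t] = [set t] by apply/seteqP; split=> [i []//|i ->].
by rewrite esum_set1// esum1 ?adde0// => i [Ii /= it]; exact: at0.
Qed.

Section Unfolding.
Context {R : realType} {G : topologicalGroupType} {H : hilbertType R}.
Variables (mu : {measure set (borel G) -> \bar R}).
Variables (sigma : G -> G -> R[i]) (pi : G -> H -> H) (d : R).
Hypotheses (hG : hausdorff_space G) (scG : @second_countable G).
Hypotheses (haar : haar_measure mu) (rep : sigma_representation sigma pi).
Hypothesis fdim : formal_dimension mu pi d.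
Variables (Gamma : groupClosed G) (D : set (borel G)).
Hypotheses (cG : countable [set` Gamma]) (fD : fundamental_domain Gamma D).

(* The Haar measure is only left-invariant, so the integral is unfolded along
   [D^-1], whose left translates by [Gamma] tile [G]. *)
Let E : set (borel G) := [set x : G | D (x^-1)%g].

Let mE : measurable E.
Proof.
have : measurable_fun setT ((fun x => x^-1)%g : borel G -> borel G).
  by apply: continuous_borel_measurable; exact: invg_continuous.
by move=> /(_ measurableT D fD.1); rewrite setTI.
Qed.

Let coef (w f : H) (x : borel G) : \bar R := (rnorm (inner w (pi x f)) ^+ 2)%:E.

Let coef0 w f x : (0 <= coef w f x)%E. Proof. by rewrite lee_fin sqr_ge0. Qed.

Let mcoefM w f (g : G) : measurable_fun setT (fun x : borel G => coef w f (g * x)%g).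
Proof. exact: (measurableT_comp (measurable_coef rep w f) (@measurable_lmul _ g)). Qed.

Let orbitE w f x : orbit_sum pi Gamma (pi x f) w =
  (\esum_(y in [set` Gamma]) coef w f (y^-1 * x)%g)%E.
Proof.
by apply: eq_esum => y _; rewrite rnorm_innerC (rnorm_inner_repV rep).
Qed.

Lemma measurable_orbit_sum w f :
  measurable_fun setT (fun x : borel G => orbit_sum pi Gamma (pi x f) w).
Proof.
under eq_fun do rewrite orbitE.
by apply: measurable_fun_esum => // y _; exact: mcoefM.
Qed.

(** Each [x] has exactly one [y] in [Gamma] with [y x] in [E], so the indicators [1_E (y x)] sum to
    1. Once this sum is inserted, each term is translated by [y^-1] using left invariance, which
    moves the indicator to [E] itself. *)
Lemma unfold_coef_norm2 w f :
  coef_norm2 mu pi w f = (\int[mu]_(x in E) orbit_sum pi Gamma (pi x f) w)%E.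
Proof.
pose I (x : borel G) : \bar R := (\1_E x)%:E.
have I0 x : (0 <= I x)%E by rewrite lee_fin.
have mI : measurable_fun setT I by apply/measurable_EFinP; exact: measurable_indic.
have mIM (g : G) : measurable_fun setT (fun x : borel G => I (g * x)%g).
  exact: (measurableT_comp mI (@measurable_lmul _ g)).
transitivity (\int[mu]_x (\esum_(y in [set` Gamma]) (I (y * x)%g * coef w f x)))%E.
  apply: eq_integral => x _.
  have [y [[yG Dy] yU]] := fD.2 (x^-1)%g.
  rewrite (@esum_unique _ _ _ _ (y^-1)%g).
  - by rewrite /I indicE mem_set ?mul1e//= /E /= invgM invgK.
  - by rewrite /= gpredV.
  - by move=> z; rewrite mule_ge0.
  - move=> z zG zy; rewrite /I indicE memNset ?mul0e// /E /= invgM => Dz.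
    by apply: zy; rewrite (yU (z^-1)%g) ?invgK// gpredV.
rewrite integral_esum//; first last.
- by move=> y x; rewrite mule_ge0.
- by move=> y _; apply: emeasurable_funM; [exact: mIM|exact: (measurable_coef rep w f)].
transitivity (\esum_(y in [set` Gamma]) \int[mu]_x (I x * coef w f (y^-1 * x)%g))%E.
  apply: eq_esum => y _; rewrite -(@haar_integral_lmul _ _ _ haar (y^-1)%g
    (fun x => I (y * x)%g * coef w f x)%E).
  - by apply: eq_integral => x _; rewrite mulVKg.
  - by apply: emeasurable_funM; [exact: mIM|exact: (measurable_coef rep w f)].
  - by move=> x; rewrite mule_ge0.
rewrite -integral_esum//; first last.
- by move=> y x; rewrite mule_ge0.
- by move=> y _; apply: emeasurable_funM; [exact: mI|exact: mcoefM].
rewrite [RHS]integral_mkcond; apply: eq_integral => x _.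
rewrite patchE /I indicE; case: (boolP (x \in E)) => xE.
  by rewrite orbitE; apply: eq_esum => y _; rewrite mul1e.
by rewrite esum1// => y _; rewrite mul0e.
Qed.

Section Volume.
Variables (eta h : H).
Hypothesis eta0 : eta != 0.

Let volD : mu E = mu D.
Proof. by rewrite /E (haar_inv hG scG haar rep fdim eta0) //; case: fD. Qed.

Let rhsE :
  (fun x => orbit_sum pi Gamma (pi x eta) (eta - h)%R + (4 * rnorm (pi x eta) ^+ 2)%:E)%E
  = (fun x => orbit_sum pi Gamma (pi x eta) (eta - h)%R + (4 * rnorm eta ^+ 2)%:E)%E.
Proof. by apply/funext => x; rewrite (rep_rnorm rep). Qed.

Let int_orbitD : (\int[mu]_(x in E) (orbit_sum pi Gamma (pi x eta) (eta - h)%R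
    + (4 * rnorm (pi x eta) ^+ 2)%:E) =
  coef_norm2 mu pi (eta - h)%R eta + (4 * rnorm eta ^+ 2)%:E * mu D)%E.
Proof.
rewrite rhsE ge0_integralD//.
- by rewrite -unfold_coef_norm2 integral_cst// volD.
- by move=> x _; exact: orbit_sum_ge0.
- by apply: measurable_funS (measurable_orbit_sum _ _).
- by move=> x _; rewrite lee_fin mulr_ge0 ?sqr_ge0.
Qed.

(** By the orthogonality relations the two coefficient norms are proportional to [|eta + h|^2] and
    [|eta - h|^2], whose difference is [4 <h, eta>]; the positive factor [4 |eta|^2 / d] then
    cancels. *)
Let solve_volume (r : R) : (coef_norm2 mu pi (eta + h)%R eta <=
    coef_norm2 mu pi (eta - h)%R eta + (4 * rnorm eta ^+ 2)%:E * r%:E)%E =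
  (rinner h eta <= r * d).
Proof.
have [d0 dE] := fdim; have e0 : 0 < rnorm eta ^+ 2.
  by rewrite exprn_gt0// lt0r rnorm_ge0 rnorm_eq0 eta0.
rewrite !dE -EFinM -EFinD lee_fin -subr_ge0.
rewrite (_ : _ - _ = 4 * rnorm eta ^+ 2 / d * (r * d - rinner h eta)).
  have c0 : 0 < 4 * rnorm eta ^+ 2 / d by rewrite divr_gt0// mulr_gt0.
  by rewrite (pmulr_rge0 _ c0) subr_ge0.
rewrite !rnorm2E !(rinnerBl, rinnerBr) !(rinnerDl, rinnerDr) (rinnerC eta h).
by field; rewrite gt_eqF.
Qed.

Lemma volume_ge : (forall g, (orbit_sum pi Gamma g (eta + h)%R <=
    orbit_sum pi Gamma g (eta - h)%R + (4 * rnorm g ^+ 2)%:E)%E) ->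
  ((rinner h eta)%:E <= mu D * d%:E)%E.
Proof.
move=> le; have [d0 dE] := fdim.
have muD0 : (0 <= mu D)%E by [].
have : (coef_norm2 mu pi (eta + h)%R eta <= coef_norm2 mu pi (eta - h)%R eta +
    (4 * rnorm eta ^+ 2)%:E * mu D)%E.
  rewrite -int_orbitD unfold_coef_norm2; apply: ge0_le_integral => //.
  - by move=> x _; exact: orbit_sum_ge0.
  - by apply: measurable_funS (measurable_orbit_sum _ _).
  - rewrite rhsE; apply: emeasurable_funD; last exact: measurable_cst.
    by apply: measurable_funS (measurable_orbit_sum _ _).
case: (mu D) muD0 => [r|_ _|//]; last by rewrite mulyr gtr0_sg// mul1e leey.
by rewrite solve_volume lee_fin.
Qed.

Lemma volume_eq : (forall g, (orbit_sum pi Gamma g (eta + h)%R =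
    orbit_sum pi Gamma g (eta - h)%R + (4 * rnorm g ^+ 2)%:E)%E) ->
  ((rinner h eta)%:E = mu D * d%:E)%E.
Proof.
move=> eq; have [d0 dE] := fdim.
have : (coef_norm2 mu pi (eta + h)%R eta = coef_norm2 mu pi (eta - h)%R eta +
    (4 * rnorm eta ^+ 2)%:E * mu D)%E.
  by rewrite -int_orbitD unfold_coef_norm2; apply: eq_integral => x _; rewrite eq.
have muD0 : (0 <= mu D)%E by [].
have e0 : 0 < 4 * rnorm eta ^+ 2.
  by rewrite mulr_gt0// exprn_gt0// lt0r rnorm_ge0 rnorm_eq0 eta0.
case: (mu D) muD0 => [r _|_|//].
  rewrite -EFinM => eqr; apply/eqP; rewrite eqe eq_le -solve_volume.
  (* With the equality [eqr] substituted, [solve_volume] at [t] compares [r] with [t]; taking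
     [t = <h, eta> / d] yields [r d <= <h, eta>]. *)
  have r_le t : rinner h eta <= t * d -> r <= t.
    rewrite -solve_volume eqr -EFinM leeD2lE ?dE// lee_fin.
    by rewrite ler_pM2l.
  rewrite -EFinM eqr lexx /= -ler_pdivlMr// r_le// divfK ?gt_eqF//.
(* Infinite measure of [D] is excluded, the coefficient norm on the left being finite. *)
by rewrite !dE mulry gtr0_sg// mul1e.
Qed.

End Volume.
End Unfolding.

(** * Riesz sequences *)

Section RieszFamilies.
Context {R : realType} {H : hilbertType R} {T : choiceType}.
Implicit Types (X : set T) (g : T -> H) (F : {fset T}) (c : T -> R[i]).

Definition energy X g (f : H) : \bar R :=
  \esum_(i in X) (rnorm (inner f (g i)) ^+ 2)%:E.

Definition riesz_bounds X g (A B : R) : Prop :=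
  forall F c, [set` F] `<=` X ->
    A * (\sum_(i <- F) rnorm (c i) ^+ 2)
      <= rnorm (\sum_(i <- F) c i *: g i) ^+ 2
      <= B * (\sum_(i <- F) rnorm (c i) ^+ 2).

Lemma esum_fset_EFin X F (a : T -> R) : (forall i, 0 <= a i) ->
  [set` F] `<=` X -> (forall i, i \notin F -> a i = 0) ->
  \esum_(i in X) (a i)%:E = (\sum_(i <- F) a i)%:E.
Proof.
move=> a0 FX aF.
rewrite (esumID [set` F]) => [|i _]; last by rewrite lee_fin.
rewrite [X in (_ + X)%E]esum1 ?adde0; last first.
  by move=> i [_ /= /negP iF]; rewrite aF.
rewrite (setIidr FX) esum_fset; last 2 first.
- exact: finite_fset.
- by move=> i _; rewrite lee_fin.
by rewrite fsbig_finite// set_fsetK sumEFin.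
Qed.

Lemma riesz_sequence_bounds X g : is_riesz_sequence X g ->
  exists A B : R, [/\ 0 < A, A <= B & riesz_bounds X g A B].
Proof.
move=> [_ [A [B [A0 AB rz]]]]; exists A, B; split=> // F c FX.
pose c' i := if i \in F then c i else 0.
have r0 : rnorm (0 : R[i]) = 0 by rewrite /rnorm normr0.
have l2 : l2norm2 X c' = (\sum_(i <- F) rnorm (c i) ^+ 2)%:E.
  rewrite /l2norm2 (esum_fset_EFin (F := F))//.
  - congr EFin; rewrite !big_seq; apply: eq_bigr => i iF.
    by rewrite /c' iF.
  - by move=> i; rewrite sqr_ge0.
  - by move=> i /negbTE iF; rewrite /c' iF r0 expr0n.
have [|s sum_s] := rz c'; first by rewrite l2 ltry.
rewrite l2 -!EFinM !lee_fin.
(* The coefficients [c'] vanish off [F], so the partial sums are constant past [F] and the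
   unconditional sum is the finite combination. *)
suff -> : s = \sum_(i <- F) c i *: g i by [].
apply/eqP; rewrite -subr_eq0 -rnorm_eq0; apply/eqP/le_anti.
rewrite rnorm_ge0 andbT; apply/ler_addgt0Pr => e e0; rewrite add0r.
have [F0 F0X F0P] := sum_s e e0.
have := F0P (F0 `|` F)%fset (fsubsetUl _ _).
have FUX : [set` (F0 `|` F)%fset] `<=` X.
  by move=> i /=; rewrite in_fsetU => /orP[/F0X|/FX].
move=> /(_ FUX)/ltW; congr (_ <= _); congr (rnorm (_ - _)).
rewrite -(big_fset_incl _ (fsubsetUr F0 F)) /=; last first.
  by move=> i _ /negbTE iF; rewrite /c' iF scale0r.
by rewrite !big_seq; apply: eq_bigr => i iF; rewrite /c' iF.
Qed.

(** Duality with the upper Riesz bound: for [w], the finite combination with coefficients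
    [<f, g_i>], both [<w, f> = t] and [|w|^2 <= B t]. Young's inequality gives
    [2 t <= t + B |f|^2]. *)
Lemma riesz_bessel X g (A B : R) f : 0 < B -> riesz_bounds X g A B ->
  (energy X g f <= (B * rnorm f ^+ 2)%:E)%E.
Proof.
move=> B0 rz; apply: ge_ereal_sup => _ [S [finS SX] <-].
rewrite fsbig_finite// sumEFin lee_fin.
set F := fset_set S; set t := \sum_(i <- F) _.
have FX : [set` F] `<=` X by rewrite /F fset_setK.
have /andP[_] := rz F (fun i => inner f (g i)) FX; rewrite -/t.
set w := \sum_(i <- F) _ => wt.
have wf : rinner w f = t.
  rewrite /rinner /w /t; elim/big_ind2: _ => [|x1 x2 y1 y2 <- <-|i _].
  - by rewrite linear0l.
  - by rewrite innerDl raddfD.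
  - by rewrite innerZl (innerC (g i)) rnorm_complexE; case: (inner f _) => a b /=; ring.
have := @rinner_young _ _ B^-1 w f; rewrite invr_gt0 B0 invrK wf => /(_ isT).
have : B^-1 * rnorm w ^+ 2 <= t by rewrite ler_pdivrMl.
lra.
Qed.

End RieszFamilies.

(** * Cosets of [Lambda] in [Gamma] *)

Section Cosets.
Context {R : realType} {G : topologicalGroupType} {H : hilbertType R}.
Variables (sigma : G -> G -> R[i]) (pi : G -> H -> H).
Hypothesis rep : sigma_representation sigma pi.
Variables (eta : H) (Gamma Lambda : groupClosed G) (u : G -> R[i]).
Hypotheses (LG : [set` Lambda] `<=` [set` Gamma]) (finL : finite_set [set` Lambda]).
Hypothesis uP : forall x, x \in Lambda -> `|u x| = 1 /\ pi x eta = u x *: eta.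

Let L : R := #|` fset_set [set` Lambda]|%:R.

Lemma card_Lambda_gt0 : 0 < L.
Proof.
rewrite /L ltr0n cardfs_gt0; apply/fset0Pn; exists 1%g.
by rewrite in_fset_set// inE /= gpred1.
Qed.

Let esum_Lambda (a : R) : 0 <= a ->
  \esum_(x in [set` Lambda]) a%:E = (L * a)%:E.
Proof.
move=> a0; rewrite esum_fset//.
rewrite fsbig_finite// sumEFin big_const_seq count_predT iter_addr_0.
by rewrite /L mulr_natl.
Qed.

Let inner_Lambda f x y : y \in Lambda ->
  rnorm (inner f (pi (x * y)%g eta)) = rnorm (inner f (pi x eta)).
Proof.
move=> /uP[u1 yeta]; rewrite -(rnorm_inner_repM rep) yeta (repZ rep) innerZr.
by rewrite rnormM rnorm_conj [rnorm (u y)]/rnorm u1 mul1r.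
Qed.

Lemma orbit_sum_ge_Lambda f :
  ((L * rnorm (inner f eta) ^+ 2)%:E <= orbit_sum pi Gamma f eta)%E.
Proof.
rewrite -esum_Lambda ?sqr_ge0// /orbit_sum [leRHS](esumID [set` Lambda]) => [|i _]; last first.
  by rewrite lee_fin sqr_ge0.
rewrite (setIidr LG); apply: le_trans (leeDl _ _); last first.
  by apply: esum_ge0 => i _; rewrite lee_fin sqr_ge0.
apply: le_esum => x xL; rewrite lee_fin -(mul1g x) inner_Lambda//.
by case: rep => _ _ -> _ _.
Qed.

Variable X : set G.
Hypothesis XP : coset_representatives Gamma Lambda X.

Let prod_bij : set_bij (X `*` [set` Lambda]) [set` Gamma] (fun p => (p.1 * p.2)%g).
Proof.
split.
- by move=> [x y] [/XP.1 xG /LG yG]; rewrite /= gpredM.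
- move=> [x y] [x' y']; rewrite !inE => -[/= Xx yL] [/= Xx' yL'] eq.
  have xyG : (x * y)%g \in Gamma by apply: gpredM; [exact: (XP.1 _ Xx)|exact: (LG yL)].
  have [z [_ zU]] := XP.2 _ xyG.
  have zx : z = x by apply: zU; rewrite mulKg.
  have zx' : z = x' by apply: zU; rewrite eq mulKg.
  by move: eq; rewrite -zx -zx' => /mulgI ->.
- move=> g gG; have [x [[Xx xgL] _]] := XP.2 _ gG.
  by exists (x, x^-1 * g)%g => //=; rewrite mulVKg.
Qed.

(** Links the family over [X] of the Riesz hypothesis to the [Gamma]-invariant full sum: the terms
    are constant on each coset of [Lambda]. *)
Lemma orbit_sum_coset f : (orbit_sum pi Gamma f eta =
  L%:E * energy X (fun x => pi x eta) f)%E.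
Proof.
rewrite /orbit_sum (reindex_esum _ _ _ _ prod_bij).
rewrite (_ : X `*` [set` Lambda] = X `*`` (fun=> [set` Lambda])); last by [].
rewrite -(@esum_esum _ _ _ X (fun=> [set` Lambda])
  (fun x y => (rnorm (inner f (pi (x * y)%g eta)) ^+ 2)%:E)); last first.
  by move=> x y _ _; rewrite lee_fin sqr_ge0.
rewrite -esumZ ?ltW ?card_Lambda_gt0//; last by move=> i _; rewrite lee_fin sqr_ge0.
apply: eq_esum => x Xx; rewrite -EFinM -esum_Lambda ?sqr_ge0//.
by apply: eq_esum => y yL; rewrite inner_Lambda.
Qed.

(** Supplies, in the Riesz case, the countability of [Gamma] used for unfolding. *)
Lemma countable_cosets : countable X -> countable [set` Gamma].
Proof.
move=> cX; have <- : (fun p : G * G => (p.1 * p.2)%g) @` (X `*` [set` Lambda]) = [set` Gamma].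
  have [fX _ sX] := prod_bij; apply/seteqP; split=> [_ [p pX <-]|//].
  exact: fX.
apply: (@sub_countable _ _ _ (X `*` [set` Lambda])); first exact: card_image_le.
by apply: countableX => //; exact: finite_set_countable.
Qed.

End Cosets.

(** * The regularized equation for a Riesz sequence *)

Section RieszDual.
Context {R : realType} {H : hilbertType R} {T : choiceType}.
Variables (X : set T) (g : T -> H) (A B : R) (q : H -> R).
Hypotheses (A0 : 0 < A) (B0 : 0 < B) (rz : riesz_bounds X g A B).
Hypothesis qE : forall f, energy X g f = (q f)%:E.

Let qB f : q f <= B * rnorm f ^+ 2.
Proof. by rewrite -lee_fin -qE; exact: riesz_bessel rz. Qed.

Let S (F : {fset T}) (f : H) : R := \sum_(i <- F) rnorm (inner f (g i)) ^+ 2.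

Let tailE F f : [set` F] `<=` X ->
  energy (X `&` ~` [set` F]) g f = (q f - S F f)%:E.
Proof.
move=> FX; have : energy X g f = ((S F f)%:E + energy (X `&` ~` [set` F]) g f)%E.
  rewrite /energy (esumID [set` F]) => [|i _]; last by rewrite lee_fin sqr_ge0.
  congr (_ + _)%E; rewrite (setIidr FX) esum_fset//; last first.
    by move=> i _; rewrite lee_fin sqr_ge0.
  by rewrite fsbig_finite// set_fsetK sumEFin.
rewrite qE => /esym; case: (energy _ _ _) => [r| |] //=.
by move=> -[eqr]; congr EFin; lra.
Qed.

(** The tail is again a sum of squared coefficients, over the indices of [X] outside [F], so Young's
    inequality and the parallelogram law apply to it. *)
Let tail_quadratic F : [set` F] `<=` X -> quadratic (fun f => q f - S F f).
Proof.
move=> FX; apply: (quadratic_esum (fun i _ => quadratic_inner (g i))) => f.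
by rewrite -tailE.
Qed.

Let small_tail (h : H) (k : R) (x0 : T) : 0 < k -> X x0 -> exists F : {fset T},
  [/\ [set` F] `<=` X, x0 \in F & q h - S F h <= k].
Proof.
move=> k0 Xx0; have : ((q h - k)%:E < energy X g h)%E by rewrite qE lte_fin gtrBl.
move=> /ereal_sup_gt[_ [Y [finY YX] <-]].
rewrite fsbig_finite// sumEFin lte_fin => hY.
exists (x0 |` fset_set Y)%fset; split.
- by move=> i /=; rewrite in_fset1U => /orP[/eqP ->//|]; rewrite in_fset_set// inE => /YX.
- by rewrite fset1U1.
suff : S (fset_set Y) h <= S (x0 |` fset_set Y)%fset h by rewrite /S; lra.
rewrite /S [leRHS](big_fsetID _ (mem (fset_set Y))) /=.
rewrite (_ : [fset x | x in _ & _] = fset_set Y)%fset; last first.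
  apply/fsetP => i; rewrite !inE /=.
  by case: (i \in fset_set Y); rewrite ?orbT ?andbT ?andbF.
by rewrite lerDl sumr_ge0// => i _; rewrite sqr_ge0.
Qed.

Variables (eta h : H) (L e : R) (x0 : T) (a : R[i]).
Hypotheses (L0 : 0 < L) (Xx0 : X x0) (a1 : `|a| = 1) (gx0 : g x0 = a *: eta).
Hypothesis hP : forall v, L * q (h + v) + e * rnorm (h + v) ^+ 2
  - (L * q (h - v) + e * rnorm (h - v) ^+ 2) = 4 * rinner v eta.

(* [h] solves [L sum <h, g_i> g_i + e h = eta], so the coefficient of
   [g x0] in the combination [eta - L sum_F <h, g_i> g_i] has modulus at least
   [1 - L <h, eta>], while the combination itself is [e h] up to the tail. *)
Lemma riesz_dual_bound : A * (1 - L * rinner h eta) ^+ 2 <= 2 * e ^+ 2 * rnorm h ^+ 2.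
Proof.
(* The slack is [2 |r|^2] for the truncation error [r] below, coming from
   [|r + e h|^2 <= 2 |r|^2 + 2 e^2 |h|^2]; [k] bounds the tail of [q h]. *)
apply: (@le_of_small_slack _ _ _ (2 * L ^+ 2 * B)) => k /andP[k0 _].
have [F [FX x0F Fk]] := small_tail h k0 Xx0.
pose w := \sum_(i <- F) inner h (g i) *: g i.
have [r rdef] : exists r, r = eta - L%:C *: w - e%:C *: h by eexists.
(* By the equation of [h], [4 |r|^2] is [L] times the polarization of the tail form at [(h, r)].
   Young's weight [L * B] keeps the part in [|r|^2] down to [2 |r|^2], which is absorbed on the
   left. *)
have rk : rnorm r ^+ 2 <= L ^+ 2 * B * k.
  have Tq := tail_quadratic FX.
  have wr : S F (h + r) - S F (h - r) = 4 * rinner r w.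
    rewrite /S /w /rinner -sumrB; elim/big_ind2: _ => [|x1 x2 y1 y2 -> ->|i _].
    - by rewrite linear0r mulr0.
    - by rewrite innerDr raddfD mulrDr.
    - rewrite innerDl innerBl innerZr !rnorm_complexE.
      by case: (inner h _) (inner r _) => [x y] [x' y'] /=; ring.
  have LB0 : 0 < L * B by rewrite mulr_gt0.
  have S0 f : 0 <= S F f by rewrite /S sumr_ge0// => i _; rewrite sqr_ge0.
  have Tdiff : q (h + r) - S F (h + r) - (q (h - r) - S F (h - r))
      <= 2 * (L * B) * k + 2 * (L^-1 * rnorm r ^+ 2).
    have := quad_young Tq h r LB0; have := quad_parallelogram Tq h r.
    have : L * B * (q h - S F h) <= L * B * k by rewrite ler_wpM2l// ltW.
    have : (L * B)^-1 * (q r - S F r) <= L^-1 * rnorm r ^+ 2.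
      rewrite invfM -mulrA ler_wpM2l ?invr_ge0 ?(ltW L0)// ler_pdivrMl//.
      by have := qB r; have := S0 r; lra.
    by lra.
  have rr : rinner r r = rinner r eta - L * rinner r w - e * rinner r h.
    by rewrite {2}rdef !rinnerBr !rinnerZr.
  have := hP r; move: rr (ler_wpM2l (ltW L0) Tdiff) (congr1 ( *%R L) wr).
  have -> : L * (2 * (L * B) * k + 2 * (L^-1 * rnorm r ^+ 2)) =
      2 * (L ^+ 2 * B * k) + 2 * rnorm r ^+ 2.
    by field; rewrite gt_eqF.
  rewrite !rnorm2E !rinnerBl !rinnerBr !rinnerDl !rinnerDr (rinnerC h r).
  by move: (q _) (q _) (S _ _) (S _ _) => ? ? ? ?; lra.
(* The index [x0] receives the extra coefficient [a^*] because [eta = a^* g x0]. *)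
have rE : r + e%:C *: h = \sum_(i <- F)
    ((if i == x0 then a^* else 0) - L%:C * inner h (g i)) *: g i.
  have -> : r + e%:C *: h = eta - L%:C *: w by rewrite rdef subrK.
  rewrite (eq_bigr (fun i => (if i == x0 then a^* else 0) *: g i -
    L%:C *: (inner h (g i) *: g i))); last by move=> i _; rewrite scalerBl scalerA.
  rewrite sumrB -scaler_sumr; congr (_ - _).
  rewrite (big_fsetD1 x0)//= eqxx big_seq big1 ?addr0.
    by rewrite gx0 scalerA mulrC -normCK a1 expr1n scale1r.
  by move=> i; rewrite in_fsetD1 => /andP[/negbTE -> _]; rewrite scale0r.
have := rz (fun i => (if i == x0 then a^* else 0) - L%:C * inner h (g i)) FX.
rewrite -rE => /andP[+ _].
rewrite (big_fsetD1 x0)//= eqxx.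
have -> : rnorm (a^* - L%:C * inner h (g x0)) ^+ 2 = rnorm (1 - L%:C * inner h eta) ^+ 2.
  rewrite gx0 innerZr mulrCA -[X in X - _]mulr1 -mulrBr rnormM rnorm_conj.
  by rewrite [rnorm a]/rnorm a1 mul1r.
set rest := \sum_(i <- _) _.
have rest0 : 0 <= rest by apply: sumr_ge0 => i _; rewrite sqr_ge0.
have coef_ge : (1 - L * rinner h eta) ^+ 2 <= rnorm (1 - L%:C * inner h eta) ^+ 2.
  rewrite rnorm_complexE /rinner; case: (inner h eta) => x y /=.
  by rewrite mul0r subr0 lerDl sqr_ge0.
have := quad_parallelogram rnorm_quadratic r (e%:C *: h).
have := sqr_ge0 (rnorm (r - e%:C *: h)).
have -> : rnorm (e%:C *: h) ^+ 2 = e ^+ 2 * rnorm h ^+ 2.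
  by rewrite !rnorm2E rinnerZl rinnerZr mulrA expr2.
have : A * (1 - L * rinner h eta) ^+ 2 <= A * (rnorm (1 - L%:C * inner h eta) ^+ 2 + rest).
  by rewrite ler_wpM2l ?(ltW A0)// (le_trans coef_ge)// lerDl.
move: rk; lra.
Qed.

End RieszDual.

Lemma le_inv_of_sqr (R : realFieldType) (L b : R) : 0 < L -> L * b ^+ 2 <= b -> b <= L^-1.
Proof.
move=> L0 Lb; have [b0|b0] := leP b 0.
  by rewrite (le_trans b0)// invr_ge0 ltW.
rewrite -(ler_pM2l L0) mulfV ?gt_eqF// -(ler_pM2r b0) mul1r -mulrA -expr2//.
Qed.

(** * The two volume inequalities *)

Theorem theorem4p6 (R : realType) (n : nat) (G : lieGroupType R n)
  (mu : {measure set (borel G) -> \bar R})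
  (H : hilbertType R) (sigma : G -> G -> R[i]) (pi : G -> H -> H)
  (d : R) (eta : H) (Gamma Lambda : groupClosed G) (X : set G)
  (vol : \bar R) :
  connected [set: G] ->
  ~ compact [set: G] ->
  semisimple_group G ->
  finite_set (group_center G) ->
  no_compact_factors G ->
  haar_measure mu ->
  discrete_series mu sigma pi ->
  formal_dimension mu pi d ->
  eta != 0 ->
  lattice (R := R) Gamma ->
  is_covolume mu Gamma vol ->
  [set` Lambda] `<=` [set` Gamma] ->
  finite_set [set` Lambda] ->
  subgroup_center Gamma `<=` [set` Lambda] ->
  (exists u : G -> R[i], forall g, g \in Lambda ->
      `|u g| = 1 /\ pi g eta = u g *: eta) ->
  coset_representatives Gamma Lambda X ->
  (is_frame [set` Gamma] (fun g => pi g eta) ->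
     (vol * d%:E <= (#|` fset_set [set` Lambda]|%:R^-1)%:E)%E) /\
  (is_riesz_sequence X (fun g => pi g eta) ->
     (vol * d%:E >= (#|` fset_set [set` Lambda]|%:R^-1)%:E)%E).
Proof.
move=> _ _ _ _ _ haar [rep _ _] fdim eta0 _ [D fD ->] LG finL _ [u uP] XP.
have hG := @lie_hausdorff R n G; have scG := @lie_second_countable R n G.
set L : R := #|` fset_set [set` Lambda]|%:R.
have L0 : 0 < L := card_Lambda_gt0 finL.
have d0 := fdim.1.
have rinner_le f : rinner f eta ^+ 2 <= rnorm (inner f eta) ^+ 2.
  by rewrite rnorm_complexE lerDl sqr_ge0.
split=> [[cG [A [B [A0 AB frame]]]]|riesz].
  have B0 : 0 <= B by rewrite (le_trans _ AB)// ltW.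
  pose q f := fine (orbit_sum pi Gamma f eta).
  have qE f : orbit_sum pi Gamma f eta = (q f)%:E.
    have /andP[_ fB] := frame f.
    by rewrite fineK// ge0_fin_numE ?orbit_sum_ge0// (le_lt_trans fB)// ltry.
  have frameq f : A * rnorm f ^+ 2 <= q f <= B * rnorm f ^+ 2.
    by have := frame f; rewrite -/(orbit_sum pi Gamma f eta) qE !lee_fin.
  (* With [e = 0], coercivity is the lower frame bound. *)
  have [f|f|h [_ hE dual]] := orbit_dual rep qE (lexx 0) A0 B0.
  - by rewrite mul0r addr0; have /andP[] := frameq f.
  - by have /andP[] := frameq f.
  rewrite -(volume_eq hG scG haar rep fdim cG fD eta0 (h := h)) => [|f]; last first.
    by have [r _] := dual f; rewrite mulr0 mul0r adde0.
  rewrite lee_fin; apply: le_inv_of_sqr => //.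
  have := orbit_sum_ge_Lambda rep LG finL uP h; rewrite qE lee_fin -/L => Lq.
  rewrite -[leRHS]hE mul0r addr0; apply: le_trans Lq.
  by rewrite ler_wpM2l// ltW.
have [cX _] := riesz; have [A [B [A0 AB rz]]] := riesz_sequence_bounds riesz.
have B0 : 0 < B := lt_le_trans A0 AB.
pose q f := fine (energy X (fun x => pi x eta) f).
have qE f : energy X (fun x => pi x eta) f = (q f)%:E.
  rewrite fineK// ge0_fin_numE; first by rewrite (le_lt_trans (riesz_bessel _ B0 rz)) ?ltry.
  by apply: esum_ge0 => i _; rewrite lee_fin sqr_ge0.
have q0 f : 0 <= q f.
  by rewrite -lee_fin -qE; apply: esum_ge0 => i _; rewrite lee_fin sqr_ge0.
have qB f : q f <= B * rnorm f ^+ 2 by rewrite -lee_fin -qE; exact: riesz_bessel rz.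
have qGE f : orbit_sum pi Gamma f eta = (L * q f)%:E.
  by rewrite (orbit_sum_coset rep LG finL uP XP) qE EFinM.
have cG : countable [set` Gamma] := countable_cosets LG finL XP cX.
(* The representative [x0] of the trivial coset lies in [Lambda], so its orbit vector is a
   unimodular multiple of [eta]. *)
have [x0 [[Xx0 x0L] _]] := XP.2 1%g gpred1.
move: x0L; rewrite mulg1 gpredV => /uP[u1 gx0].
have muD0 : (0 <= mu D)%E by [].
case E : (mu D) muD0 => [v|//|//] _; last by rewrite mulyr gtr0_sg// mul1e leey.
rewrite -EFinM lee_fin leNgt; apply/negP => vdL.
have Lvd : 0 < 1 - L * (v * d).
  by rewrite subr_gt0 -ltr_pdivlMl// mulr1.
suff : A * (1 - L * (v * d)) ^+ 2 <= 0 by rewrite leNgt mulr_gt0// exprn_gt0.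
(* If [v d < 1/L], then [e |h|^2 <= <h, eta> <= v d] bounds [2 e^2 |h|^2] by [e * (2 / L)], which
   vanishes with [e]. *)
apply: (@le_of_small_slack _ _ _ (2 / L)) => e /andP[e0 _]; rewrite add0r.
have LB0 : 0 <= L * B by rewrite mulr_ge0 ?ltW.
(* Here the regularization [e] itself serves as the coercivity constant. *)
have [f|f|h [hP hE dual]] := orbit_dual rep qGE (ltW e0) e0 LB0.
- by rewrite lerDr mulr_ge0// ltW.
- by rewrite -mulrA ler_wpM2l// ltW.
have vol_ge : rinner h eta <= v * d.
  rewrite -lee_fin EFinM -E; apply: (volume_ge hG scG haar rep fdim cG fD eta0) => f.
  by have [r r0 <-] := dual f; rewrite leeDl// lee_fin !mulr_ge0// ltW.
have eh : e * rnorm h ^+ 2 <= L^-1.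
  rewrite (@le_trans _ _ (rinner h eta))//; last by rewrite (le_trans vol_ge)// ltW.
  by rewrite -hE lerDr mulr_ge0// ltW.
have := riesz_dual_bound A0 B0 rz qE L0 Xx0 u1 gx0 hP.
have : A * (1 - L * (v * d)) ^+ 2 <= A * (1 - L * rinner h eta) ^+ 2.
  rewrite ler_wpM2l ?(ltW A0)// ler_pXn2r ?nnegrE ?(ltW Lvd)//.
    by rewrite lerD2l lerN2 ler_pM2l.
  by rewrite (le_trans (ltW Lvd))// lerD2l lerN2 ler_pM2l.
have : e * (e * rnorm h ^+ 2) <= e * L^-1 by rewrite ler_wpM2l// ltW.
lra.
Qed.
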